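(* Let $\mathbf U=\mathbf H(z,\mathbf U)$ be an irreducible system of dimension $m$, let $\mathbf U(z)$ be its generating function solution and $\rho$ its radius of convergence. Let $u$ be a coordinate of $\mathbf U$ such that $u(\rho)>1$. Then there exists $\boldsymbol\zeta=(t,\mathbf B)\in(0,\rho)\times\mathbb R_{\ge0}^m$ with $u(t)=1$ and $\mathbf B=\mathbf U(t)$, and a neighborhood of $\boldsymbol\zeta$ such that Newton's iteration for the system $\{\mathbf U=\mathbf H(z,\mathbf U),\ u=1\}$ (in the unknowns $z,\mathbf U$) converges quadratically to $\boldsymbol\zeta$ when started in this neighborhood.
   Context: Let $\mathbf H=(H_1,\dots,H_m)$, written $\mathbf H(z,\mathbf U)$, be analytic near $\mathbf 0\in\mathbb C^{m+1}$; its domain of convergence is that of its Taylor series at $\mathbf 0$. The system is well founded when (i) each $H_i$ has nonnegative real Taylor coefficients at $\mathbf 0$; (ii) with $\mathbf V^{[0]}=\mathbf 0$, for $k=0,\dots,m$, $(0,\mathbf V^{[k]})$ lies in the domain of convergence, so that $\mathbf V^{[k+1]}=\mathbf H(0,\mathbf V^{[k]})$ is defined; (iii) $\partial\mathbf H/\partial\mathbf U$ at $(0,\mathbf V^{[m]})$ is nilpotent. The generating function solution is the unique solution analytic near $0$ with value $\mathbf V^{[m]}$ at $0$; $u(\rho)$ means its limit as $z\to\rho^-$ (possibly $+\infty$). The system is irreducible if it is well founded, zero-free (no coordinate of the solution identically zero), recursive ($\partial\mathbf H/\partial\mathbf U$ not nilpotent) and its dependency graph (edge $i\to j$ when $H_i$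 depends on $U_j$) is strongly connected.
   Formalization: The hypothesis u(0)<1 is added; without it the claim fails, e.g. for U=2+zU with solution 2/(1−z), where u(ρ)=+∞>1 but u≥2 on [0,1), so no t in (0,ρ) has u(t)=1. *)

(* Defs.v *)
From HB Require Import structures.
From mathcomp Require Import all_boot all_order all_algebra.
From mathcomp Require Import complex.
From mathcomp Require Import all_classical all_reals all_analysis.
Set Implicit Arguments.
Unset Strict Implicit.
Unset Printing Implicit Defensive.
Import Order.TTheory GRing.Theory Num.Theory.
Import numFieldNormedType.Exports.
Local Open Scope classical_set_scope.
Local Open Scope ring_scope.
Local Open Scope complex_scope.

(* R[i] viewed as a numFieldType, so that it and the matrices over it receive
   the topology and the norm of numFieldNormedType.  The order is the partial
   order of R[i]: 0 <= c means that c is a nonnegative real number. *)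
Definition Cplx (R : realType) : numFieldType := R[i].

Definition toC (R : realType) (x : R) : Cplx R := x%:C.
Definition reC (R : realType) (z : Cplx R) : R := complex.Re z.

Section MultivariateSeries.
Variable R : realType.
Local Notation C := (Cplx R).

Definition mcoefs (n : nat) := {ffun 'I_n -> nat} -> C.

(* Partial sums of sum_k a_k x^k over the boxes {k | k_i < N for all i}; for an
   absolutely convergent series every exhaustion of the multi-indices gives the
   same sum. *)
Definition mseries n (a : mcoefs n) (x : 'rV[C]_n) (N : nat) : C :=
  \sum_(k : {ffun 'I_n -> 'I_N})
    a [ffun i => val (k i)] * \prod_(i < n) x 0 i ^+ val (k i).

Definition abs_cvg n (a : mcoefs n) : set 'rV[C]_n :=
  [set x | cvgn (mseries (fun k => `|a k|) (map_mx Num.norm x))].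

Definition msum n (a : mcoefs n) (x : 'rV[C]_n) : C := limn (mseries a x).

End MultivariateSeries.

Section Systems.
Variables (R : realType) (m : nat).
Local Notation C := (Cplx R).

(* A germ of analytic map at 0 in C^(m+1) is given by its Taylor coefficients;
   variable 0 is z and variable j.+1 is U_j. *)
Definition system := 'I_m -> mcoefs R (1 + m).
Implicit Type h : system.

Definition conv_dom h : set 'rV[C]_(1 + m) :=
  interior [set x | forall i, abs_cvg (h i) x].

Definition sys_map h (x : 'rV[C]_(1 + m)) : 'rV[C]_m := \row_i msum (h i) x.

Definition zU_point (z : C) (v : 'rV[C]_m) : 'rV[C]_(1 + m) :=
  row_mx (z%:M : 'M[C]_1) v.

(* The library Jacobian acts on row vectors: 'J f x j i is the derivative of the
   i-th component with respect to the j-th variable. *)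
Definition dHdU h (x : 'rV[C]_(1 + m)) : 'M[C]_m :=
  (dsubmx ('J (sys_map h) x))^T.

Definition wf_iter h (k : nat) : 'rV[C]_m :=
  iter k (fun v => sys_map h (zU_point 0 v)) 0.

Definition well_founded_system h : Prop :=
  [/\ conv_dom h 0,
      forall i k, 0 <= h i k,
      forall k, (k <= m)%N -> conv_dom h (zU_point 0 (wf_iter h k)) &
      exists p : nat, dHdU h (zU_point 0 (wf_iter h m)) ^+ p = 0].

(* m univariate power series, the i-th one having coefficients u i. *)
Definition gf := 'I_m -> nat -> C.
Implicit Type u : gf.

Definition gf_cvg u : set C :=
  [set z | forall i, cvgn (series (fun n => u i n * z ^+ n))].

Definition gf_val u (z : C) : 'rV[C]_m :=
  \row_i limn (series (fun n => u i n * z ^+ n)).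

Definition gf_solution h u : Prop :=
  [/\ \forall z \near (0 : C), gf_cvg u z,
      \forall z \near (0 : C), conv_dom h (zU_point z (gf_val u z)) /\
        gf_val u z = sys_map h (zU_point z (gf_val u z)) &
      gf_val u 0 = wf_iter h m].

Definition conv_radius u : \bar R :=
  ereal_sup [set (reC `|z|)%:E | z in gf_cvg u].

(* The limit is taken in \bar R along x < conv_radius u, which also covers an
   infinite radius of convergence. *)
Definition value_at_radius u (i : 'I_m) : \bar R :=
  lim ((reC (gf_val u (toC (fine x)) 0 i))%:E
       @[x --> within (fun y : \bar R => (y < conv_radius u)%E) (nbhs (conv_radius u))]).

Definition zero_free h : Prop :=
  forall u, gf_solution h u ->
  forall i, ~ \forall z \near (0 : C), gf_val u z 0 i = 0.

(* dH/dU is not nilpotent as a matrix of analytic functions. *)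
Definition recursive h : Prop :=
  ~ exists p : nat, forall x, conv_dom h x -> dHdU h x ^+ p = 0.

Definition depends_on h (i j : 'I_m) : Prop :=
  exists k : {ffun 'I_(1 + m) -> nat}, (0 < k (rshift 1 j))%N /\ h i k != 0.

Definition dependency_graph h : rel 'I_m := fun i j => `[< depends_on h i j >].

Definition irreducible_system h : Prop :=
  [/\ well_founded_system h, zero_free h, recursive h &
      forall i j, connect (dependency_graph h) i j].

(* The m + 1 equations U_i = 1 and U = H(z, U), in the form F = 0. *)
Definition augmented_map h (i : 'I_m) (x : 'rV[C]_(1 + m)) : 'rV[C]_(1 + m) :=
  zU_point (rsubmx x 0 i - 1) (rsubmx x - sys_map h x).

End Systems.

Section Newton.
Variables (R : realType) (n : nat).
Local Notation C := (Cplx R).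
Implicit Types (F : 'rV[C]_n -> 'rV[C]_n) (D : set 'rV[C]_n).

Definition newton_step F (x : 'rV[C]_n) : 'rV[C]_n :=
  x - F x *m invmx ('J F x).

(* The iteration is well defined along x0 when every iterate lies in the domain
   D of F and the Jacobian is invertible there. *)
Definition newton_cvg_quadratically_near F D (zeta : 'rV[C]_n) : Prop :=
  exists2 W : set 'rV[C]_n, nbhs zeta W &
  exists K : R, forall x0, W x0 ->
    let x k := iter k (newton_step F) x0 in
    [/\ forall k, D (x k) /\ 'J F (x k) \in unitmx,
        x k @[k --> \oo] --> zeta &
        forall k, `|x k.+1 - zeta| <= toC K * `|x k - zeta| ^+ 2].

End Newton.

(* Main.v *)
(* The coefficients of [U] are nonnegative: with [A] the transpose of the
   nilpotent matrix dH/dU at (0, V^[m]), the n-th coefficient [u] satisfies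
   [u = u A + g], where [g] is the n-th Taylor coefficient of [H(z, P(z))] for the
   truncation [P] of [U] below degree n.  By monotone convergence the equation
   U = H(z, U) then holds on the whole interval [0, rho), so that (t, U(t)) is
   interior to the domain of convergence because every coordinate of U is
   strictly increasing (irreducibility).  The intermediate value theorem gives
   t with u(t) = 1.  For t < t' < rho, convexity of H along the positive orthant
   makes w = U(t') - U(t) a positive strict supersolution of w >= M w, with
   M = dH/dU at (t, U(t)); since M is irreducible, a minimum principle shows that
   the Jacobian of the augmented system is injective.  Quadratic convergence of
   Newton's iteration follows from a second-order expansion of H with a
   remainder that is uniform near (t, U(t)). *)

From HB Require Import structures.
From mathcomp Require Import all_boot all_order all_algebra.
From mathcomp Require Import complex.
From mathcomp Require Import ring lra.
From mathcomp Require Import all_classical all_reals all_analysis.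
Require Import Defs.
Set Implicit Arguments.
Unset Strict Implicit.
Unset Printing Implicit Defensive.
Import Order.TTheory GRing.Theory Num.Theory.
Import numFieldNormedType.Exports.
Local Open Scope classical_set_scope.
Local Open Scope ring_scope.

(** * Newton iteration *)

(** [gf_solution] gives the equation only near 0. Nothing is known beforehand about the signs of the
    coefficients of [U], nor about the convergence of [H] at [(z, U(z))] further out, so the
    composition is never formed as a power series. Its place is taken by increasing sequences of
    polynomials with nonnegative coefficients, whose suprema are compared through their upper bounds
    and may thus be handled before they are known to be finite. Coefficients are identified by
    orders of vanishing at 0 along the positive reals. Nonnegativity of the coefficients has to
    precede all monotone convergence; it rests on nilpotency, since [u = g + u A] is solved by a
    finite Neumann sum. The strictness of the supersolution comes from the variable z: some [H_j]
    depends on it, because otherwise [U] would be constant, against u(0) < 1 = u(t). Without such an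
    equation the z-row of the augmented Jacobian would vanish. *)

Section MatrixNorm.
Variable K : numFieldType.

Lemma mx_norm_le m n (A : 'M[K]_(m, n)) e :
  0 <= e -> (forall i j, `|A i j| <= e) -> `|A| <= e.
Proof.
move=> /nonnegP[{}e] Ae; rewrite /Num.norm/= mx_normE num_le.
apply/bigmax_leP => /=; split; last by case=> i j _; exact: Ae.
by rewrite -num_le /=.
Qed.

Lemma ler_entry_norm m n (A : 'M[K]_(m, n)) i j : `|A i j| <= `|A|.
Proof.
rewrite [leRHS]/Num.norm/= mx_normE.
have -> : `|A i j| = `|A (i, j).1 (i, j).2|%:nng%:num by [].
by rewrite num_le; exact: (le_bigmax _ (fun ij => `|A ij.1 ij.2|%:nng)).
Qed.

Lemma ler_norm_mulmx m n (x : 'rV[K]_m) (A : 'M[K]_(m, n)) :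
  `|x *m A| <= (m%:R * `|A|) * `|x|.
Proof.
apply: mx_norm_le => [|i j]; first by rewrite !mulr_ge0.
rewrite mxE; apply: le_trans (ler_norm_sum _ _ _) _.
have -> : m%:R * `|A| * `|x| = \sum_(k < m) `|x| * `|A|.
  by rewrite sumr_const card_ord -[RHS]mulr_natl mulrAC mulrA.
by apply: ler_sum => k _; rewrite normrM ler_pM ?ler_entry_norm.
Qed.

Lemma mulmx_continuous m n (A : 'M[K]_(m, n)) :
  continuous (fun x : 'rV[K]_m => x *m A).
Proof.
move=> x; apply/(@cvgrPdist_lt _ _ _ (nbhs (x : 'rV[K]_m)) _) => e e0.
have k0 : 0 < m%:R * `|A| + 1 by rewrite ltr_wpDl ?mulr_ge0.
near=> y; rewrite -mulmxBl; apply: le_lt_trans (ler_norm_mulmx _ _) _.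
apply: le_lt_trans (_ : _ <= (m%:R * `|A| + 1) * `|x - y|) _.
  by rewrite ler_wpM2r// lerDl.
rewrite mulrC -ltr_pdivlMr//; near: y.
by apply: cvgr_dist_lt => //; rewrite divr_gt0.
Unshelve. all: by end_near. Qed.

End MatrixNorm.

(** * Second-order expansions uniform in the base point *)

Section QuadraticApproximation.
Variables (K : numFieldType) (n p : nat).

(** Both points vary, which makes the bound uniform in the base point. This alone yields
    differentiability at each point of the ball and a Lipschitz estimate for [L]; no second
    derivative is formed. *)
Definition quad_approx (F : 'rV[K]_n -> 'rV[K]_p) (L : 'rV[K]_n -> 'M[K]_(n, p))
    (x0 : 'rV[K]_n) (d B : K) : Prop :=
  forall x y, `|x - x0| < d -> `|y - x0| < d ->
    `|F y - F x - (y - x) *m L x| <= B * `|y - x| ^+ 2.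

Variables (F : 'rV[K]_n -> 'rV[K]_p) (L : 'rV[K]_n -> 'M[K]_(n, p)).
Variables (x0 : 'rV[K]_n) (d B : K).
Hypotheses (d_gt0 : 0 < d) (B_ge0 : 0 <= B) (FL : quad_approx F L x0 d B).

Lemma quad_approx_jacobian (x : 'rV[K]_n) : `|x - x0| < d -> 'J F x = L x.
Proof.
move=> xd; suff dF : 'd F x = mulmxr (L x) :> (_ -> _).
  apply/matrixP => i j; rewrite /jacobian.
  have := mul_rV_lin1 ('d F x) (delta_mx 0 i).
  by rewrite dF/= -!rowE => /rowP/(_ j); rewrite !mxE.
apply: diff_unique; first exact: mulmx_continuous.
apply/eqaddoP => e e0.
have small r : 0 < r -> \forall y \near nbhs (0 : 'rV[K]_n), `|y| < r.
  move=> r0; apply/nbhs_ballP; exists r => //= y.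
  by rewrite -ball_normE/= sub0r normrN.
near=> y.
rewrite opprD addrA.
rewrite [X in `|X|](_ : _ = F (y + x) - F x - y *m L x); last by [].
have := FL xd (y := y + x); rewrite addrK => FLy.
apply: le_trans (FLy _) _.
  have -> : y + x - x0 = (x - x0) + y by rewrite -addrA addrC.
  apply: le_lt_trans (ler_normD _ _) _; rewrite addrC -ltrBrDr.
  by near: y; apply: small; rewrite subr_gt0.
rewrite expr2 mulrA ler_wpM2r//.
apply: le_trans (_ : _ <= (B + 1) * `|y|) _; first by rewrite ler_wpM2r// lerDl.
rewrite mulrC -ler_pdivlMr ?ltr_wpDl//.
by apply: ltW; near: y; apply: small; rewrite divr_gt0 ?ltr_wpDl.
Unshelve. all: by end_near. Qed.

(* Compare the second-order expansions at [x0] and at [x] on the triangle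
   [x0, x, x + e], where [e] is rescaled to have the length of [x - x0]. *)
Lemma quad_approx_lipschitz (x e : 'rV[K]_n) : `|x - x0| + `|x - x0| < d ->
  `|e *m (L x - L x0)| <= (6%:R * B) * `|x - x0| * `|e|.
Proof.
move=> xd; set r := `|x - x0|.
have r0 : 0 <= r by exact: normr_ge0.
have [/eqP|rN0] := eqVneq r 0.
  rewrite normr_eq0 subr_eq0 => /eqP ->.
  by rewrite subrr mulmx0 normr0 !mulr_ge0.
have rgt0 : 0 < r by rewrite lt_def rN0.
have key (f : 'rV[K]_n) : `|f| = r -> `|f *m (L x - L x0)| <= 6%:R * B * r * r.
  move=> fr.
  have xr : r < d by apply: le_lt_trans xd; rewrite lerDl.
  have xfE : x + f - x0 = (x - x0) + f by rewrite addrAC.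
  have xf2 : `|x + f - x0| <= r + r by rewrite xfE -{2}fr ler_normD.
  have xfd : `|x + f - x0| < d by apply: le_lt_trans xf2 xd.
  have x00 : `|x0 - x0| < d by rewrite subrr normr0.
  have h1 := FL xr xfd; have h2 := FL x00 xfd; have h3 := FL x00 xr.
  have fE : x + f - x = f by rewrite addrC addKr.
  rewrite fE in h1.
  have -> : f *m (L x - L x0) =
      - (F (x + f) - F x - f *m L x)
      + (F (x + f) - F x0 - (x + f - x0) *m L x0)
      - (F x - F x0 - (x - x0) *m L x0).
    rewrite xfE mulmxDl mulmxBr.
    move: (F (x + f)) (F x) (F x0) (f *m L x) (f *m L x0) ((x - x0) *m L x0).
    move=> a b c u v w; apply/matrixP => i j; rewrite !mxE; ring.
  apply: le_trans (ler_normB _ _) _.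
  apply: le_trans (lerD (ler_normD _ _) (lexx _)) _; rewrite normrN.
  apply: le_trans (lerD (lerD h1 h2) h3) _; rewrite fr.
  (* The sides of the triangle have lengths r, at most 2 r, and r; B (1 + 4 + 1) r^2 accounts for
     the constant 6. *)
  have : B * `|x + f - x0| ^+ 2 <= B * (r + r) ^+ 2.
    by rewrite ler_wpM2l// lerXn2r// nnegrE// addr_ge0.
  rewrite -/r => h.
  apply: le_trans (lerD (lerD (lexx _) h) (lexx _)) _.
  by rewrite le_eqVlt; apply/orP; left; apply/eqP; ring.
have [->|eN0] := eqVneq e 0; first by rewrite mul0mx !normr0 mulr0.
have ne0 : 0 < `|e| by rewrite normr_gt0.
have := key ((r / `|e|) *: e).
rewrite normrZ normrM normfV !normr_id divfK ?gt_eqF//.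
move=> /(_ erefl); rewrite -scalemxAl normrZ normrM normfV !normr_id.
rewrite -/r (mulrC (r / _)) mulrA (mulrAC _ r) ler_pM2r// => h.
by rewrite -ler_pdivrMr.
Qed.

End QuadraticApproximation.

(** * Limits of sequences, real and complex *)

Section FieldLimits.
Variable K : numFieldType.
Implicit Types (s t : nat -> K) (a b c : K).

Lemma cvg_seqB s t a b : s n @[n --> \oo] --> a -> t n @[n --> \oo] --> b ->
  s n - t n @[n --> \oo] --> a - b.
Proof. by move=> sa tb; exact: cvgB. Qed.

Lemma cvg_seqBl s a b : s n @[n --> \oo] --> a ->
  s n - b @[n --> \oo] --> a - b.
Proof. by move=> sa; apply: cvg_seqB => //; exact: cvg_cst. Qed.

Lemma cvg_seqMl s a c : s n @[n --> \oo] --> a ->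
  c * s n @[n --> \oo] --> c * a.
Proof. by move=> sa; apply: cvgMr. Qed.

Lemma cvg_seq_sum (I : finType) (f : I -> nat -> K) (l : I -> K) :
  (forall i, f i n @[n --> \oo] --> l i) ->
  \sum_i f i n @[n --> \oo] --> \sum_i l i.
Proof.
move=> fl; rewrite unlock; elim: (index_enum I) => [|i r IH] /=.
  exact: cvg_cst.
by apply: cvgD => //; exact: fl.
Qed.

End FieldLimits.

Section ComplexBasics.
Variable R : realType.
Local Notation C := (Cplx R).

Definition imC (z : C) : R := complex.Im z.

HB.instance Definition _ := GRing.RMorphism.copy (@toC R) (real_complex R).

Lemma reC_is_additive : additive (@reC R).
Proof. by case=> a b [c d]. Qed.
HB.instance Definition _ :=
  GRing.isAdditive.Build (Cplx R) R (@reC R) reC_is_additive.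

Lemma imC_is_additive : additive imC.
Proof. by case=> a b [c d]. Qed.
HB.instance Definition _ := GRing.isAdditive.Build (Cplx R) R imC imC_is_additive.

Lemma toCK (x : R) : reC (toC x) = x. Proof. by []. Qed.

Lemma imC_toC (x : R) : imC (toC x) = 0. Proof. by []. Qed.

Lemma reC_toCM (x : R) (z : C) : reC (toC x * z) = x * reC z.
Proof. by case: z => a b; rewrite /reC/= mul0r subr0. Qed.

Lemma imC_toCM (x : R) (z : C) : imC (toC x * z) = x * imC z.
Proof. by case: z => a b; rewrite /imC/= mul0r addr0. Qed.

Lemma reC_imC_eq (z w : C) : reC z = reC w -> imC z = imC w -> z = w.
Proof. by case: z w => [a b] [c d]; rewrite /reC /imC/= => -> ->. Qed.

Lemma le_toC (x y : R) : (toC x <= toC y) = (x <= y).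
Proof. exact: lecR. Qed.

Lemma lt_toC (x y : R) : (toC x < toC y) = (x < y).
Proof. exact: ltcR. Qed.

Lemma toC_ge0 (x : R) : (0 <= toC x) = (0 <= x).
Proof. exact: (le_toC 0). Qed.

Lemma toC_gt0 (x : R) : (0 < toC x) = (0 < x).
Proof. exact: (lt_toC 0). Qed.

Lemma ge0_toC (z : C) : 0 <= z -> z = toC (reC z).
Proof. by case: z => a b; rewrite lecE => /andP[/eqP/= -> _]. Qed.

Lemma reC_le (z w : C) : z <= w -> reC z <= reC w.
Proof. by case: z w => [a b] [c d]; rewrite lecE => /andP[]. Qed.

Lemma reC_ge0 (z : C) : 0 <= z -> 0 <= reC z.
Proof. exact: reC_le. Qed.

Lemma norm_toC (x : R) : `|toC x| = toC `|x| :> C.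
Proof. by rewrite /toC normc_def/= expr0n/= addr0 sqrtr_sqr. Qed.

Lemma normCE (z : C) : `|z| = toC (reC `|z|).
Proof. exact: ge0_toC. Qed.

Lemma mx_normCE m n (A : 'M[C]_(m, n)) : `|A| = toC (reC `|A|).
Proof. exact: ge0_toC. Qed.

Lemma ler_norm_reC (z : C) : `|reC z| <= reC `|z|.
Proof.
rewrite /reC normc_def/= -sqrtr_sqr ler_wsqrtr// lerDl sqr_ge0 //.
Qed.

Lemma ler_norm_imC (z : C) : `|imC z| <= reC `|z|.
Proof. by rewrite /reC normc_def/= -sqrtr_sqr ler_wsqrtr// lerDr sqr_ge0. Qed.

Lemma ler_norm_reC_imC (z : C) : reC `|z| <= `|reC z| + `|imC z|.
Proof.
rewrite /reC /imC normc_def/= -[leRHS]ger0_norm ?addr_ge0//.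
rewrite -[leRHS]sqrtr_sqr ler_wsqrtr// sqrrD !real_normK ?num_real//.
by rewrite addrAC lerDl mulrn_wge0// mulr_ge0.
Qed.

Lemma cvgC_reC (s : nat -> C) (l : C) :
  s n @[n --> \oo] --> l -> reC (s n) @[n --> \oo] --> reC l.
Proof.
move=> /cvgrPdist_lt sl; apply/cvgrPdist_lt => e e0.
have /sl : 0 < toC e by rewrite toC_gt0.
apply: filterS => n; rewrite -raddfB normCE lt_toC; apply: le_lt_trans.
exact: ler_norm_reC.
Qed.

Lemma cvgC_imC (s : nat -> C) (l : C) :
  s n @[n --> \oo] --> l -> imC (s n) @[n --> \oo] --> imC l.
Proof.
move=> /cvgrPdist_lt sl; apply/cvgrPdist_lt => e e0.
have /sl : 0 < toC e by rewrite toC_gt0.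
apply: filterS => n; rewrite -raddfB normCE lt_toC; apply: le_lt_trans.
exact: ler_norm_imC.
Qed.

Lemma cvgC_re_im (s : nat -> C) (l : C) :
  reC (s n) @[n --> \oo] --> reC l -> imC (s n) @[n --> \oo] --> imC l ->
  s n @[n --> \oo] --> l.
Proof.
move=> /cvgrPdist_lt sr /cvgrPdist_lt si; apply/cvgrPdist_lt => e e0.
have e0' := ltW e0; rewrite (ge0_toC e0') toC_gt0 in e0 *.
have e20 : 0 < reC e / 2 by rewrite divr_gt0.
near=> n; rewrite normCE lt_toC.
apply: le_lt_trans (ler_norm_reC_imC _) _; rewrite [ltRHS]splitr !raddfB.
by apply: ltrD; near: n; [exact: sr|exact: si].
Unshelve. all: by end_near. Qed.

Lemma cvgC_toC (s : nat -> R) (l : R) :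
  s n @[n --> \oo] --> l -> toC (s n) @[n --> \oo] --> toC l.
Proof.
by move=> sl; apply: cvgC_re_im => //; rewrite imC_toC; exact: cvg_cst.
Qed.

Lemma cvgC_norm_le (s : nat -> C) (l a b : C) (N : nat) :
  s n @[n --> \oo] --> l -> (forall n, (N <= n)%N -> `|s n - a| <= b) ->
  `|l - a| <= b.
Proof.
move=> sl sab; have b0 : 0 <= b by apply: le_trans (sab N _).
rewrite normCE (ge0_toC b0) le_toC; apply/ler_addgt0Pr => e e0.
have /cvgrPdist_lt/(_ (toC e)) := sl; rewrite toC_gt0 => /(_ e0)[M _ hM].
have /= lM := hM (maxn M N) (leq_maxl _ _).
have sN := sab (maxn M N) (leq_maxr _ _).
suff : `|l - a| <= b + toC e by move=> /reC_le; rewrite raddfD.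
have -> : l - a = (l - s (maxn M N)) + (s (maxn M N) - a).
  by rewrite addrA subrK.
by rewrite [leRHS]addrC; apply: le_trans (ler_normD _ _) (lerD (ltW lM) sN).
Qed.

(** Nonnegativity in [Cplx R] includes being real, so the imaginary parts have to be shown to
    converge to 0 as well. *)
Lemma cvgC_ge0 (s : nat -> C) (l : C) (N : nat) :
  s n @[n --> \oo] --> l -> (forall n, (N <= n)%N -> 0 <= s n) -> 0 <= l.
Proof.
move=> sl s0; have rl := cvgC_reC sl; have il := cvgC_imC sl.
have -> : l = toC (reC l).
  apply: reC_imC_eq => //; rewrite imC_toC.
  rewrite -(cvg_lim _ il)//; apply: (@lim_near_cst R) => //.
  by exists N => // n /= Nn; rewrite (ge0_toC (s0 _ Nn)).
rewrite toC_ge0 -(cvg_lim _ rl)//; apply: limr_ge.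
  by apply/cvg_ex; exists (reC l).
by exists N => // n /= Nn; apply: reC_ge0; exact: s0.
Qed.

End ComplexBasics.

(** * Local quadratic convergence of Newton's iteration *)

Section NewtonConvergence.
Variables (R : realType) (n : nat).
Local Notation C := (Cplx R).

Lemma unitmx_of_injective (K : fieldType) (A : 'M[K]_n) :
  (forall v : 'rV[K]_n, v *m A = 0 -> v = 0) -> A \in unitmx.
Proof.
move=> h; rewrite -row_free_unit -kermx_eq0; apply/rowV0P => v.
by move=> /sub_kermxP/h.
Qed.

Lemma cvg_of_halving (x : nat -> 'rV[C]_n) (l : 'rV[C]_n) :
  (forall k, `|x k.+1 - l| * 2 <= `|x k - l|) -> x k @[k --> \oo] --> l.
Proof.
move=> hx.
have hk k : `|x k - l| * 2 ^+ k <= `|x 0%N - l|.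
  elim: k => [|k]; first by rewrite expr0 mulr1.
  by apply: le_trans; rewrite exprS mulrA ler_wpM2r ?exprn_ge0.
apply/cvgrPdist_lt => e e0.
have e0' := ltW e0; rewrite (ge0_toC e0') toC_gt0 in e0 *.
set b := reC `|x 0%N - l|.
have [M Mb] : exists M, b / reC e < M%:R.
  by exists (Num.truncn (b / reC e)).+1; exact: truncnS_gt.
exists M => // k /= Mk; rewrite distrC mx_normCE lt_toC.
have pk : (0 : R) < 2 ^+ k by rewrite exprn_gt0.
have h2 : reC `|x k - l| * 2 ^+ k <= b.
  have := hk k; rewrite [X in X * _]mx_normCE [X in _ <= X]mx_normCE -/b.
  have -> : 2 ^+ k = toC (2 ^+ k) :> C by rewrite rmorphXn/= rmorph_nat.
  by rewrite -rmorphM/= le_toC.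
rewrite -(ltr_pM2r pk); apply: le_lt_trans h2 _.
rewrite -ltr_pdivrMl// mulrC; apply: lt_le_trans Mb _.
rewrite -natrX ler_nat; apply: leq_trans Mk _.
by rewrite ltnW// ltn_expl.
Qed.

(** Since [F zeta = 0], the new error multiplied by [L x] is [F zeta - F x - (zeta - x) *m L x], a
    second-order remainder based at [x]. What remains is a bound on the inverse of [L x] that is
    uniform near [zeta], obtained by perturbation from [L zeta]. *)
Theorem newton_quadratic (F : 'rV[C]_n -> 'rV[C]_n) (L : 'rV[C]_n -> 'M[C]_n)
    (D : set 'rV[C]_n) (zeta : 'rV[C]_n) (d B : C) :
  0 < d -> 0 <= B -> quad_approx F L zeta d B ->
  (forall x, `|x - zeta| < d -> D x) -> F zeta = 0 -> L zeta \in unitmx ->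
  newton_cvg_quadratically_near F D zeta.
Proof.
move=> d0 B0 FL hD F0 Lu.
have [k k0 hk] : exists2 k : C, 0 <= k &
    forall e : 'rV[C]_n, `|e| <= k * `|e *m L zeta|.
  exists (n%:R * `|invmx (L zeta)|); first by rewrite mulr_ge0.
  by move=> e; rewrite -{1}(mulmxK Lu e); exact: ler_norm_mulmx.
(* The radius [c^-1] gives 2 |x - zeta| < d, as [quad_approx_lipschitz] requires, and 16 k B |x -
   zeta| <= 1. The latter covers the factor 12 k B, needed to absorb the variation of [L] into half
   of |e|, and the factor 4 k B, needed for one step to halve the error. *)
pose c := d^-1 * 2 + 16%:R * (k * B).
have kB0 : 0 <= k * B by rewrite mulr_ge0.
have c0 : 0 < c by rewrite ltr_wpDr ?mulr_ge0// mulr_gt0// invr_gt0.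
have small x : `|x - zeta| < c^-1 ->
    `|x - zeta| + `|x - zeta| < d /\ 16%:R * (k * B) * `|x - zeta| <= 1.
  move=> xc; have {}xc : c * `|x - zeta| < 1.
    by rewrite -(ltr_pM2l c0) divff ?gt_eqF in xc.
  split.
    rewrite -(ltr_pM2l (x := d^-1)) ?invr_gt0// mulVf ?gt_eqF//.
    apply: le_lt_trans xc; rewrite -mulr2n -mulr_natl mulrA ler_wpM2r//.
    by rewrite lerDl mulr_ge0.
  apply: le_trans (ltW xc); rewrite ler_wpM2r// lerDr mulr_ge0//.
  by rewrite invr_ge0 ltW.
have inv x (e : 'rV[C]_n) : `|x - zeta| < c^-1 -> `|e| <= 2 * k * `|e *m L x|.
  move=> /small[xd xB].
  have h : `|e *m L zeta| <= `|e *m L x| + 6%:R * B * `|x - zeta| * `|e|.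
    apply: le_trans (lerD (lexx _) (quad_approx_lipschitz d0 B0 FL e xd)).
    rewrite mulmxBr; apply: le_trans (ler_normB _ _).
    by rewrite opprB addrC subrK.
  have {}h := le_trans (hk e) (ler_wpM2l k0 h).
  rewrite -(lerD2r `|e|) -[leLHS]mulr2n -[leLHS]mulr_natl.
  apply: le_trans (ler_wpM2l (ler0n _ 2) h) _.
  rewrite mulrDr mulrDr mulrA lerD2l -[leRHS]mul1r !mulrA ler_wpM2r//.
  apply: le_trans xB; rewrite !mulrA ler_wpM2r//.
  have -> : 2 * k * 6%:R * B = 12%:R * (k * B) by ring.
  have -> : 16%:R * k * B = 16%:R * (k * B) by ring.
  by rewrite ler_wpM2r// ler_nat.
pose Q := 2 * (k * B).
have Jx x : `|x - zeta| < c^-1 -> 'J F x = L x.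
  move=> /small[xd _]; apply: (quad_approx_jacobian B0 FL).
  by apply: le_lt_trans xd; rewrite lerDl.
have ux x : `|x - zeta| < c^-1 -> L x \in unitmx.
  move=> xc; apply: unitmx_of_injective => v vL; apply/eqP.
  by rewrite -normr_le0; apply: le_trans (inv _ v xc) _; rewrite vL normr0 mulr0.
have step x : `|x - zeta| < c^-1 ->
    `|newton_step F x - zeta| <= Q * `|x - zeta| ^+ 2.
  move=> xc; have [xd _] := small _ xc.
  apply: le_trans (inv _ _ xc) _.
  have -> : (newton_step F x - zeta) *m L x =
      F zeta - F x - (zeta - x) *m L x.
    rewrite /newton_step (Jx _ xc) F0 addrAC mulmxBl mulmxKV ?ux//.
    by rewrite sub0r -[zeta - x]opprB mulNmx opprK [LHS]addrC.
  rewrite /Q mulrA -[leRHS]mulrA; apply: ler_wpM2l; first by rewrite mulr_ge0.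
  rewrite -normrN [in leRHS]distrC normrN; apply: FL; last by rewrite subrr normr0.
  by apply: le_lt_trans xd; rewrite lerDl.
have halve x : `|x - zeta| < c^-1 -> `|newton_step F x - zeta| * 2 <= `|x - zeta|.
  move=> xc; have [_ xB] := small _ xc.
  apply: le_trans (ler_wpM2r (ler0n _ 2) (step _ xc)) _.
  rewrite expr2 mulrA mulrAC -[leRHS]mul1r ler_wpM2r//.
  apply: le_trans xB; rewrite mulrAC ler_wpM2r// /Q mulrC (mulrA 2 2).
  by rewrite ler_wpM2r// -natrM ler_nat.
have stay x : `|x - zeta| < c^-1 -> `|newton_step F x - zeta| < c^-1.
  move=> xc; apply: le_lt_trans (xc); apply: le_trans (halve _ xc).
  by rewrite ler_peMr// ler1n.
exists (ball zeta c^-1); first by apply: nbhsx_ballx; rewrite invr_gt0.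
exists (reC Q) => x0; rewrite -ball_normE/= distrC => x0c /=.
have xc j : `|iter j (newton_step F) x0 - zeta| < c^-1.
  by elim: j => // j; exact: stay.
split.
- move=> j; split; last by rewrite (Jx _ (xc j)); exact: ux (xc j).
  apply: hD; have [xd _] := small _ (xc j).
  by apply: le_lt_trans xd; rewrite lerDl.
- by apply: cvg_of_halving => j; exact: halve (xc j).
- move=> j; rewrite -ge0_toC; first exact: step (xc j).
  by rewrite /Q mulr_ge0.
Qed.

End NewtonConvergence.

(** * Box sums and monomials *)

Section BoxSums.
Variable n : nat.
Local Notation mi := {ffun 'I_n -> nat}.

(** The index sets of [mseries] with arbitrary terms in a commutative monoid, so that the same
    splitting lemmas serve numbers and polynomials. *)
Definition boxsum (V : nmodType) (f : mi -> V) (N : nat) : V :=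
  \sum_(k : {ffun 'I_n -> 'I_N}) f [ffun i => val (k i)].

Lemma boxsum_sub (V : nmodType) (f : mi -> V) N M : (N <= M)%N ->
  boxsum f N = \sum_(k : {ffun 'I_n -> 'I_M} | [forall i, (k i < N)%N])
    f [ffun i => val (k i)].
Proof.
move=> NM; pose w (k : {ffun 'I_n -> 'I_N}) := [ffun i => widen_ord NM (k i)].
have w_inj : injective w.
  move=> k k' /ffunP kk'; apply/ffunP => i; apply: val_inj.
  by have /(congr1 val) := kk' i; rewrite !ffunE.
transitivity (\sum_(k in w @: [set: {ffun 'I_n -> 'I_N}])
    f [ffun i => val (k i)]).
  rewrite big_imset/=; last by move=> k k' _ _; exact: w_inj.
  rewrite /boxsum; apply: eq_big => [k|k _]; first by rewrite in_setT.
  by congr f; apply/ffunP => i; rewrite !ffunE.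
apply: eq_bigl => k; apply/imsetP/forallP => [[k' _ ->] i|kN].
  by rewrite ffunE/=.
exists [ffun i => Ordinal (kN i)]; rewrite ?in_setT//.
by apply/ffunP => i; rewrite !ffunE; apply: val_inj.
Qed.

Lemma boxsum_split (V : nmodType) (f : mi -> V) N M : (N <= M)%N ->
  boxsum f M = boxsum f N +
    \sum_(k : {ffun 'I_n -> 'I_M} | ~~ [forall i, (k i < N)%N])
      f [ffun i => val (k i)].
Proof.
move=> NM; rewrite (boxsum_sub f NM) /boxsum.
by rewrite (bigID (fun k : {ffun 'I_n -> 'I_M} => [forall i, (k i < N)%N])).
Qed.

Lemma eq_boxsum (V : nmodType) (f g : mi -> V) : f =1 g -> boxsum f =1 boxsum g.
Proof. by move=> fg N; apply: eq_bigr => k _. Qed.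

Lemma boxsum_single (V : nmodType) (f : mi -> V) (k0 : mi) : exists N0,
  forall N, (N0 <= N)%N -> exists k1 : {ffun 'I_n -> 'I_N},
    f k0 = f [ffun i => val (k1 i)].
Proof.
exists (\sum_i k0 i).+1 => N N0.
have kN i : (k0 i < N)%N.
  by apply: leq_trans N0; rewrite ltnS (bigD1 i)//= leq_addr.
exists [ffun i => Ordinal (kN i)]; congr f.
by apply/ffunP => i; rewrite !ffunE.
Qed.

Section Numeric.
Variable K : numDomainType.
Implicit Types f g : mi -> K.

Lemma boxsum_ge0 f N : (forall k, 0 <= f k) -> 0 <= boxsum f N.
Proof. by move=> f0; apply: sumr_ge0 => k _. Qed.

Lemma le_boxsum f g N : (forall k, f k <= g k) -> boxsum f N <= boxsum g N.
Proof. by move=> fg; apply: ler_sum => k _. Qed.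

Lemma boxsum_homo f N M : (forall k, 0 <= f k) -> (N <= M)%N ->
  boxsum f N <= boxsum f M.
Proof. by move=> f0 NM; rewrite (boxsum_split f NM) lerDl sumr_ge0. Qed.

Lemma boxsum_ge_term f k0 : (forall k, 0 <= f k) -> exists N0,
  forall N, (N0 <= N)%N -> f k0 <= boxsum f N.
Proof.
move=> f0; have [N0 hN] := boxsum_single f k0; exists N0 => N /hN[k1 ->].
by rewrite /boxsum (bigD1 k1)//= lerDl sumr_ge0.
Qed.

Lemma boxsumD f g N :
  boxsum (fun k => f k + g k) N = boxsum f N + boxsum g N.
Proof. exact: big_split. Qed.

Lemma boxsumB f g N :
  boxsum (fun k => f k - g k) N = boxsum f N - boxsum g N.
Proof. exact: sumrB. Qed.

Lemma boxsumZ c f N : boxsum (fun k => c * f k) N = c * boxsum f N.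
Proof. by rewrite /boxsum mulr_sumr. Qed.

Lemma boxsum_sum (I : finType) (F : I -> mi -> K) N :
  boxsum (fun k => \sum_i F i k) N = \sum_i boxsum (F i) N.
Proof. exact: exchange_big. Qed.

End Numeric.

Variable R : realType.
Local Notation C := (Cplx R).

Lemma toC_boxsum (f : mi -> R) N : toC (boxsum f N) = boxsum (fun k => toC (f k)) N.
Proof. exact: rmorph_sum. Qed.

Lemma reC_boxsum (f : mi -> C) N : reC (boxsum f N) = boxsum (fun k => reC (f k)) N.
Proof. exact: raddf_sum. Qed.

Lemma imC_boxsum (f : mi -> C) N : imC (boxsum f N) = boxsum (fun k => imC (f k)) N.
Proof. exact: raddf_sum. Qed.

Lemma bounded_boxsum_cvg (f : mi -> R) B : (forall k, 0 <= f k) ->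
  (forall N, boxsum f N <= B) -> cvgn (boxsum f).
Proof.
move=> f0 fB; apply: nondecreasing_is_cvgn.
  by move=> N M NM; exact: boxsum_homo.
by exists B => _ [N _ <-].
Qed.

(** Write [f] as [(f + g) - g]: both parts have nonnegative terms, and [f + g] is at most
    [g + g]. *)
Lemma dominated_boxsum_cvgR (f g : mi -> R) B : (forall k, `|f k| <= g k) ->
  (forall N, boxsum g N <= B) -> cvgn (boxsum f).
Proof.
move=> fg gB; have g0 k : 0 <= g k by apply: le_trans (fg k).
have fgB k : - g k <= f k <= g k by rewrite -ler_norml.
have -> : boxsum f = boxsum (fun k => f k + g k) \- boxsum g.
  by apply/funext => N /=; rewrite boxsumD addrK.
apply: is_cvgB; last exact: bounded_boxsum_cvg gB.
apply: (@bounded_boxsum_cvg _ (B + B)) => [k|N].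
  by have /andP[h _] := fgB k; rewrite -lerBlDr sub0r.
rewrite boxsumD lerD//; apply: le_trans (gB N); apply: le_boxsum => k.
by have /andP[] := fgB k.
Qed.

Lemma dominated_boxsum (f : mi -> C) (g : mi -> R) B :
  (forall k, `|f k| <= toC (g k)) -> (forall N, boxsum g N <= B) ->
  cvgn (boxsum f) /\ `|limn (boxsum f)| <= toC B.
Proof.
move=> fg gB.
have fg' k : reC `|f k| <= g k by have /reC_le := fg k.
have fc : cvgn (boxsum f).
  have cr : cvgn (boxsum (fun k => reC (f k))).
    apply: (@dominated_boxsum_cvgR _ g B) => // k.
    exact: le_trans (ler_norm_reC _) (fg' k).
  have ci : cvgn (boxsum (fun k => imC (f k))).
    apply: (@dominated_boxsum_cvgR _ g B) => // k.
    exact: le_trans (ler_norm_imC _) (fg' k).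
  apply/cvg_ex; exists (Complex (limn (boxsum (fun k => reC (f k))))
    (limn (boxsum (fun k => imC (f k)))) : C).
  apply: cvgC_re_im.
  - under eq_fun do rewrite reC_boxsum.
    exact: cr.
  - under eq_fun do rewrite imC_boxsum.
    exact: ci.
split=> //; rewrite -[X in `|X|]subr0.
apply: (@cvgC_norm_le _ _ _ _ _ 0 fc) => N _; rewrite subr0.
apply: le_trans (ler_norm_sum _ _ _) _.
have : toC (boxsum g N) <= toC B by rewrite le_toC.
by apply: le_trans; rewrite toC_boxsum; exact: ler_sum.
Qed.

Lemma boxsum_term_le_lim (f : mi -> C) k0 : (forall k, 0 <= f k) ->
  cvgn (boxsum f) -> f k0 <= limn (boxsum f).
Proof.
move=> f0 fc; have [N0 hN] := boxsum_ge_term k0 f0.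
rewrite -subr_ge0.
apply: (@cvgC_ge0 _ (fun N => boxsum f N - f k0) _ N0).
  exact: cvg_seqBl.
by move=> N /hN; rewrite subr_ge0.
Qed.

End BoxSums.

(** * Monomials, their differentials and their majorants *)

Section Monomials.
Variable n : nat.
Local Notation mi := {ffun 'I_n -> nat}.

Definition monomial (K : comPzRingType) (k : mi) (x : 'I_n -> K) : K :=
  \prod_i x i ^+ k i.

(** At [k l = 0] the truncated predecessor is 0, which is harmless since the factor [(k l)%:R]
    vanishes. *)
Definition dmonomial (K : comPzRingType) (k : mi) (l : 'I_n) (x : 'I_n -> K) : K :=
  (k l)%:R * x l ^+ (k l).-1 * \prod_(j | j != l) x j ^+ k j.

(* The arguments of [P] stand for the value at [x], the differential at [x]
   along [e], the value at [y] and a majorant of a function; the product step is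
   the Leibniz rule. *)
Lemma monomial_ind (K : comNzRingType) (P : K -> K -> K -> K -> Prop)
    (x e y Y : 'I_n -> K) :
  P 1 0 1 1 ->
  (forall a a' b A c c' d B, P a a' b A -> P c c' d B ->
     P (a * c) (a * c' + a' * c) (b * d) (A * B)) ->
  (forall i, P (x i) (e i) (y i) (Y i)) ->
  forall k, P (monomial k x) (\sum_l e l * dmonomial k l x)
              (monomial k y) (monomial k Y).
Proof.
move=> P1 PM Px k.
have Pexp i j : P (x i ^+ j) (e i * (j%:R * x i ^+ j.-1)) (y i ^+ j) (Y i ^+ j).
  elim: j => [|j IH]; first by rewrite !expr0 mul0r mulr0.
  rewrite !exprS; have := PM _ _ _ _ _ _ _ _ (Px i) IH.
  congr (P _ _ _ _); case: j {IH} => [|j].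
    by rewrite /= !expr0 mul0r !mulr0 add0r !mulr1.
  rewrite /= exprS -[j.+2%:R]natr1; ring.
have Pseq (s : seq 'I_n) : uniq s -> P (\prod_(i <- s) x i ^+ k i)
    (\sum_(l <- s) e l * ((k l)%:R * x l ^+ (k l).-1 *
       \prod_(j <- s | j != l) x j ^+ k j))
    (\prod_(i <- s) y i ^+ k i) (\prod_(i <- s) Y i ^+ k i).
  elim: s => [|i s IH]; first by rewrite !big_nil.
  move=> /= /andP[si /IH{}IH]; rewrite !big_cons eqxx/=.
  have := PM _ _ _ _ _ _ _ _ (Pexp i (k i)) IH; congr (P _ _ _ _).
  rewrite addrC; congr (_ + _).
    rewrite -!mulrA; do 3! congr (_ * _).
    rewrite [LHS]big_seq [RHS]big_seq_cond; apply: eq_bigl => j.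
    by case: (boolP (j \in s)) => //= js; apply/esym/eqP => ji; rewrite -ji js in si.
  rewrite mulr_sumr !big_seq; apply: eq_bigr => l ls.
  have il : i != l by apply/eqP => il; rewrite il ls in si.
  by rewrite big_cons il; ring.
exact: Pseq (index_enum_uniq _).
Qed.

Lemma monomial_ge0 (K : numDomainType) k (x : 'I_n -> K) :
  (forall i, 0 <= x i) -> 0 <= monomial k x.
Proof. by move=> x0; apply: prodr_ge0 => i _; exact: exprn_ge0. Qed.

Lemma dmonomial_ge0 (K : numDomainType) k l (x : 'I_n -> K) :
  (forall i, 0 <= x i) -> 0 <= dmonomial k l x.
Proof.
move=> x0; rewrite !mulr_ge0 ?exprn_ge0//.
by apply: prodr_ge0 => i _; exact: exprn_ge0.
Qed.

Lemma dmonomial_gt0 (K : numDomainType) (k : mi) l (x : 'I_n -> K) :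
  (0 < k l)%N -> (forall i, 0 < x i) -> 0 < dmonomial k l x.
Proof.
move=> kl x0; rewrite !mulr_gt0 ?ltr0n ?exprn_gt0//.
by apply: prodr_gt0 => i _; exact: exprn_gt0.
Qed.

Lemma le_monomial (K : numDomainType) k (x y : 'I_n -> K) :
  (forall i, 0 <= x i) -> (forall i, x i <= y i) -> monomial k x <= monomial k y.
Proof.
move=> x0 xy; apply: ler_prod => i _; rewrite exprn_ge0//=.
by rewrite lerXn2r// nnegrE ?(le_trans (x0 i)).
Qed.

Lemma lt_monomial (K : numDomainType) (k : mi) (x y : 'I_n -> K) l :
  (0 < k l)%N -> (forall i, 0 < x i) -> (forall i, x i <= y i) -> x l < y l ->
  monomial k x < monomial k y.
Proof.
move=> kl x0 xy xyl; rewrite /monomial (bigD1 l)//= [ltRHS](bigD1 l)//=.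
apply: (@lt_le_trans _ _ (y l ^+ k l * \prod_(i | i != l) x i ^+ k i)).
  rewrite ltr_pM2r; last by apply: prodr_gt0 => i _; rewrite exprn_gt0.
  by rewrite ltrXn2r ?nnegrE ?ltW// ?(lt_trans (x0 l)) ?lt0n_neq0.
apply: ler_wpM2l.
  by rewrite exprn_ge0// (le_trans (ltW (x0 l))) ?ltW.
apply: ler_prod => i _; rewrite exprn_ge0/=; last by rewrite ltW.
by rewrite lerXn2r// nnegrE ltW// (lt_le_trans (x0 i)).
Qed.

Lemma norm_monomial (K : numDomainType) k (x : 'I_n -> K) :
  `|monomial k x| = monomial k (fun i => `|x i|).
Proof. by rewrite /monomial normr_prod; apply: eq_bigr => i _; rewrite normrX. Qed.

Section QuadraticMajorant.
Variables (K : numFieldType) (th : K).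
Hypotheses (th_ge0 : 0 <= th) (th_le1 : th <= 1).

(** For a monomial the majorant [A] is (r + d)^k, split by degree in d: [A0] is of degree 0, [A1] of
    degree 1, [A2] of degree at least 2. An increment bounded by th d brings one factor [th] per
    degree. The resulting bounds are Cauchy estimates with no constant depending on the
    exponents. *)
Definition quad_major (a a' b A : K) : Prop := exists A0 A1 A2 : K,
  [/\ [/\ 0 <= A0, 0 <= A1 & 0 <= A2], A = A0 + A1 + A2 &
  [/\ `|a| <= A0, `|a'| <= th * A1 & `|b - a - a'| <= th ^+ 2 * A2]].

Lemma quad_majorM a a' b A c c' d B : quad_major a a' b A ->
  quad_major c c' d B -> quad_major (a * c) (a * c' + a' * c) (b * d) (A * B).
Proof.
move=> [A0 [A1 [A2 [[A00 A10 A20] -> [aA a'A bA]]]]].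
move=> [B0 [B1 [B2 [[B00 B10 B20] -> [cB c'B dB]]]]].
exists (A0 * B0), (A0 * B1 + A1 * B0),
  (A0 * B2 + A2 * B0 + (A1 + A2) * (B1 + B2)).
split; [by split; rewrite ?(mulr_ge0, addr_ge0)|ring|split].
- by rewrite normrM ler_pM.
- apply: le_trans (ler_normD _ _) _; rewrite mulrDr !normrM; apply: lerD.
    by rewrite mulrCA ler_pM.
  by rewrite mulrA ler_pM.
- have -> : b * d - a * c - (a * c' + a' * c) =
      a * (d - c - c') + (b - a - a') * c
      + (a' + (b - a - a')) * (c' + (d - c - c')) by ring.
  (* Here [th <= 1] matters: a remainder of size [th ^+ 2] also counts as one of size [th], so a
     product of two deviations is again of size [th ^+ 2]. *)
  have th2 : th ^+ 2 <= th by rewrite expr2 ler_piMr.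
  have hA : `|a' + (b - a - a')| <= th * (A1 + A2).
    apply: le_trans (ler_normD _ _) _; rewrite mulrDr lerD//.
    by apply: le_trans bA _; rewrite ler_wpM2r.
  have hB : `|c' + (d - c - c')| <= th * (B1 + B2).
    apply: le_trans (ler_normD _ _) _; rewrite mulrDr lerD//.
    by apply: le_trans dB _; rewrite ler_wpM2r.
  apply: le_trans (ler_normD _ _) _; rewrite [leRHS]mulrDr; apply: lerD.
    apply: le_trans (ler_normD _ _) _; rewrite [leRHS]mulrDr !normrM; apply: lerD.
      by rewrite mulrCA ler_pM.
    by rewrite mulrA ler_pM.
  have -> : th ^+ 2 * ((A1 + A2) * (B1 + B2)) =
    (th * (A1 + A2)) * (th * (B1 + B2)) by ring.
  by rewrite normrM ler_pM.
Qed.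

Lemma monomial_quad_major (x e y Y : 'I_n -> K) :
  (forall i, exists r d : K, [/\ 0 <= r, 0 <= d & Y i = r + d] /\
     [/\ `|x i| <= r, `|e i| <= th * d & y i = x i + e i]) ->
  forall k, quad_major (monomial k x) (\sum_l e l * dmonomial k l x)
              (monomial k y) (monomial k Y).
Proof.
move=> h; apply: monomial_ind.
- exists 1, 0, 0; rewrite !subr0 subrr normr0 normr1 !mulr0 !addr0.
  by split; split.
- exact: quad_majorM.
- move=> i; have [r [d [[r0 d0 ->] [xr ed ->]]]] := h i.
  exists r, d, 0; rewrite addr0 (addrC (x i)) addrK subrr normr0 mulr0.
  by split; split.
Qed.

Lemma quad_major_bounds a a' b A : quad_major a a' b A ->
  `|a'| <= th * A /\ `|b - a - a'| <= th ^+ 2 * A.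
Proof.
move=> [A0 [A1 [A2 [[A00 A10 A20] -> [aA a'A bA]]]]]; split.
  by apply: le_trans a'A _; rewrite ler_wpM2l// addrAC lerDr addr_ge0.
by apply: le_trans bA _; rewrite ler_wpM2l ?exprn_ge0// lerDr addr_ge0.
Qed.

End QuadraticMajorant.

(** Nonnegativity of the value, of the differential along [e] and of the remainder passes to
    products, by the same expansion of the remainder as in [quad_majorM]. *)
Lemma monomial_convex (K : numFieldType) (x e : 'I_n -> K) :
  (forall i, 0 <= x i) -> (forall i, 0 <= e i) -> forall k,
  0 <= monomial k (fun i => x i + e i) - monomial k x
       - \sum_l e l * dmonomial k l x.
Proof.
move=> x0 e0 k.
pose P (a a' b A : K) := [/\ 0 <= a, 0 <= a' & 0 <= b - a - a'].
suff [] : P (monomial k x) (\sum_l e l * dmonomial k l x)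
  (monomial k (fun i => x i + e i)) (monomial k x) by [].
apply: monomial_ind => [|a a' b A c c' d B [a0 a'0 b0] [c0 c'0 d0]|i].
- by split; rewrite ?subrr.
- split; [by rewrite mulr_ge0|by rewrite addr_ge0 ?mulr_ge0|].
  have -> : b * d - a * c - (a * c' + a' * c) =
      a * (d - c - c') + (b - a - a') * c
      + (a' + (b - a - a')) * (c' + (d - c - c')) by ring.
  by rewrite addr_ge0 ?mulr_ge0// addr_ge0 ?mulr_ge0// addr_ge0.
- by split => //; rewrite (addrC (x i)) addrK subrr.
Qed.

End Monomials.

(** * Local expansion of power series *)

Section PowerSeries.
Variables (R : realType) (n : nat).
Local Notation C := (Cplx R).
Implicit Types (a : mcoefs R n) (x y : 'rV[C]_n) (r s : 'I_n -> R).

Definition majorant a r (k : {ffun 'I_n -> nat}) : R :=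
  reC `|a k| * monomial k r.

(** The termwise derivative; that it is an entry of the library Jacobian comes out of the
    second-order expansion. *)
Definition mgrad a l x : C := limn (boxsum (fun k => a k * dmonomial k l (x 0))).

Lemma majorant_ge0 a r k : (forall i, 0 <= r i) -> 0 <= majorant a r k.
Proof. by move=> r0; rewrite mulr_ge0 ?monomial_ge0// reC_ge0. Qed.

Lemma le_majorant a r s k : (forall i, 0 <= r i) -> (forall i, r i <= s i) ->
  majorant a r k <= majorant a s k.
Proof. by move=> r0 rs; rewrite ler_wpM2l ?le_monomial// reC_ge0. Qed.

Lemma toC_monomial k r : toC (monomial k r) = monomial k (fun i => toC (r i)).
Proof. by rewrite rmorph_prod; apply: eq_bigr => i _; rewrite rmorphXn. Qed.

Lemma mseriesE a x : mseries a x = boxsum (fun k => a k * monomial k (x 0)).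
Proof.
apply/funext => N; apply: eq_bigr => k _; congr (_ * _).
by apply: eq_bigr => i _; rewrite ffunE.
Qed.

Lemma msumE a x : msum a x = limn (boxsum (fun k => a k * monomial k (x 0))).
Proof. by rewrite /msum mseriesE. Qed.

Lemma abs_mseriesE a x :
  mseries (fun k => `|a k|) (map_mx Num.norm x) =
  (fun N => toC (boxsum (majorant a (fun i => reC `|x 0 i|)) N)).
Proof.
rewrite mseriesE; apply/funext => N; rewrite toC_boxsum.
apply: eq_boxsum => k; rewrite /majorant rmorphM/= -normCE; congr (_ * _).
rewrite toC_monomial; apply: eq_bigr => i _.
by rewrite mxE -normCE.
Qed.

Lemma abs_cvgP a x : abs_cvg a x <->
  exists B, forall N, boxsum (majorant a (fun i => reC `|x 0 i|)) N <= B.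
Proof.
have m0 k : 0 <= majorant a (fun i => reC `|x 0 i|) k.
  by apply: majorant_ge0 => i; rewrite reC_ge0.
rewrite /abs_cvg/= abs_mseriesE; split=> [/cvgC_reC|[B hB]].
  set l := limn _ => hl; exists (reC l) => N; rewrite -(cvg_lim _ hl)//.
  apply: nondecreasing_cvgn_le; last by apply/cvg_ex; exists (reC l).
  by move=> N1 N2 N12; exact: boxsum_homo.
have hl := bounded_boxsum_cvg m0 hB.
by apply: (cvgP (toC (limn
  (boxsum (majorant a (fun i => reC `|x 0 i|)))))); exact: cvgC_toC hl.
Qed.

Section LocalExpansion.
Variables (a : mcoefs R n) (r : 'I_n -> R) (d B : R).
Hypotheses (r_ge0 : forall i, 0 <= r i) (d_gt0 : 0 < d).
Hypothesis aB : forall N, boxsum (majorant a (fun i => r i + d)) N <= B.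

Lemma msum_cvg x : (forall i, `|x 0 i| <= toC (r i + d)) ->
  cvgn (boxsum (fun k => a k * monomial k (x 0))).
Proof.
move=> xr; suff [] : cvgn (boxsum (fun k => a k * monomial k (x 0))) /\
  `|limn (boxsum (fun k => a k * monomial k (x 0)))| <= toC B by [].
apply: dominated_boxsum aB => k; rewrite normrM rmorphM/= -normCE ler_wpM2l//.
by rewrite norm_monomial toC_monomial le_monomial.
Qed.

(** Cauchy estimate: moving the coordinate [l] alone by [d], with [th = 1], bounds [d] times the
    derivative of each monomial by that monomial at [r + d]. The derivative series is therefore
    dominated by [d^-1] times the majorant. *)
Lemma mgrad_cvg x l : (forall i, `|x 0 i| <= toC (r i)) ->
  cvgn (boxsum (fun k => a k * dmonomial k l (x 0))).
Proof.
move=> xr; suff [] : cvgn (boxsum (fun k => a k * dmonomial k l (x 0))) /\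
  `|limn (boxsum (fun k => a k * dmonomial k l (x 0)))| <= toC (d^-1 * B) by [].
apply: (@dominated_boxsum _ _ _
  (fun k => d^-1 * majorant a (fun i => r i + d) k)); last first.
  by move=> N; rewrite boxsumZ ler_pM2l ?invr_gt0.
move=> k; pose e i : C := if i == l then toC d else 0.
pose Y i : C := toC (r i + d).
have := @monomial_quad_major n C 1 ler01 (lexx 1) (x 0) e
  (fun i => x 0 i + e i) Y.
have hyp i : exists r d : C, [/\ 0 <= r, 0 <= d & Y i = r + d] /\
     [/\ `|x 0 i| <= r, `|e i| <= 1 * d & x 0 i + e i = x 0 i + e i].
  exists (toC (r i)), (toC d); rewrite !toC_ge0 (ltW d_gt0) r_ge0 mul1r.
  split; first by rewrite /Y rmorphD.
  split => //; rewrite /e; case: ifP => _.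
    by rewrite norm_toC gtr0_norm.
  by rewrite normr0 toC_ge0 ltW.
move=> /(_ hyp k)/(quad_major_bounds ler01)[h _].
have {h} : `|toC d * dmonomial k l (x 0)| <= monomial k Y.
  move: h; rewrite mul1r (bigD1 l)//= big1 ?addr0; last first.
    by move=> i il; rewrite /e (negbTE il) mul0r.
  by rewrite /e eqxx.
rewrite normrM norm_toC (gtr0_norm d_gt0) => h.
rewrite normrM rmorphM/= rmorphM/= -normCE mulrCA ler_wpM2l//.
rewrite toC_monomial -(@ler_pM2l _ (toC d)) ?toC_gt0//.
apply: le_trans h _; rewrite mulrA -rmorphM/= divff ?gt_eqF// rmorph1 mul1r.
exact: lexx.
Qed.

Lemma msum_remainder_cvg x y : (forall i, `|x 0 i| <= toC (r i)) ->
  (forall i, `|y 0 i| <= toC (r i + d)) ->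
  boxsum (fun k => a k * (monomial k (y 0) - monomial k (x 0)
             - \sum_l (y - x) 0 l * dmonomial k l (x 0))) N @[N --> \oo] -->
  msum a y - msum a x - \sum_l (y - x) 0 l * mgrad a l x.
Proof.
move=> xr yr.
have xr' i : `|x 0 i| <= toC (r i + d).
  by apply: le_trans (xr i) _; rewrite le_toC lerDl ltW.
have -> : boxsum (fun k => a k * (monomial k (y 0) - monomial k (x 0)
             - \sum_l (y - x) 0 l * dmonomial k l (x 0))) =
    (fun N => boxsum (fun k => a k * monomial k (y 0)) N
     - boxsum (fun k => a k * monomial k (x 0)) N
     - \sum_l (y - x) 0 l * boxsum (fun k => a k * dmonomial k l (x 0)) N).
  apply/funext => N; under [in RHS]eq_bigr do rewrite -boxsumZ.
  rewrite -boxsum_sum -!boxsumB; apply: eq_boxsum => k.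
  rewrite !mulrBr mulr_sumr; congr (_ - _).
  by apply: eq_bigr => l _; rewrite mulrCA.
rewrite !msumE; apply: cvg_seqB.
  by apply: cvg_seqB; exact: msum_cvg.
by apply: cvg_seq_sum => l; apply: cvg_seqMl; exact: mgrad_cvg.
Qed.

(** With [th] the ratio of |y - x| to [d], the remainder of each monomial is at most [th ^+ 2] times
    the monomial at [r + d]; summation turns this into [th ^+ 2] times [B]. *)
Lemma msum_quad x y : (forall i, `|x 0 i| <= toC (r i)) -> `|y - x| <= toC d ->
  `|msum a y - msum a x - \sum_l (y - x) 0 l * mgrad a l x|
    <= toC (B / d ^+ 2) * `|y - x| ^+ 2.
Proof.
move=> xr yxd; pose th := `|y - x| / toC d.
have td0 : 0 < toC d by rewrite toC_gt0.
have th0 : 0 <= th by rewrite divr_ge0// ltW.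
have th1 : th <= 1 by rewrite ler_pdivrMr// mul1r.
have yx i : `|(y - x) 0 i| <= th * toC d.
  by rewrite divfK ?gt_eqF// ler_entry_norm.
have yE i : y 0 i = x 0 i + (y - x) 0 i by rewrite !mxE [RHS]addrC subrK.
have yr i : `|y 0 i| <= toC (r i + d).
  rewrite yE; apply: le_trans (ler_normD _ _) _; rewrite rmorphD lerD//.
  by apply: le_trans (ler_entry_norm _ _ _) yxd.
have rem := msum_remainder_cvg xr yr.
have thE : th ^+ 2 * toC B = toC (B / d ^+ 2) * `|y - x| ^+ 2.
  rewrite /th expr_div_n rmorphM/= fmorphV rmorphXn/=.
  by rewrite mulrC [RHS]mulrAC mulrA.
rewrite -thE (_ : th ^+ 2 = toC (reC th ^+ 2)); last first.
  by rewrite rmorphXn/= -ge0_toC.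
rewrite -rmorphM/= -(cvg_lim _ rem)//.
suff [] : cvgn (boxsum (fun k => a k * (monomial k (y 0) - monomial k (x 0)
             - \sum_l (y - x) 0 l * dmonomial k l (x 0)))) /\
  `|limn (boxsum (fun k => a k * (monomial k (y 0) - monomial k (x 0)
             - \sum_l (y - x) 0 l * dmonomial k l (x 0))))|
  <= toC (reC th ^+ 2 * B) by [].
apply: (@dominated_boxsum _ _ _
  (fun k => reC th ^+ 2 * majorant a (fun i => r i + d) k)); last first.
  by move=> N; rewrite boxsumZ ler_wpM2l// exprn_ge0// reC_ge0.
move=> k; have := @monomial_quad_major n C th th0 th1 (x 0) ((y - x) 0)
  (y 0) (fun i => toC (r i + d)).
have hyp i : exists r0 d0 : C, [/\ 0 <= r0, 0 <= d0 & toC (r i + d) = r0 + d0] /\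
     [/\ `|x 0 i| <= r0, `|(y - x) 0 i| <= th * d0 & y 0 i = x 0 i + (y - x) 0 i].
  exists (toC (r i)), (toC d); rewrite !toC_ge0 (ltW d_gt0) r_ge0.
  by split; [rewrite rmorphD|split].
move=> /(_ hyp k)/(quad_major_bounds th0)[_ h].
rewrite (_ : toC _ = `|a k| *
    (th ^+ 2 * monomial k (fun i => toC (r i + d)))).
  by rewrite normrM ler_wpM2l.
rewrite rmorphM/= rmorphXn/= -(ge0_toC th0) rmorphM/= -normCE.
by rewrite toC_monomial mulrCA.
Qed.

End LocalExpansion.
End PowerSeries.

Section SystemExpansion.
Variables (R : realType) (m : nat) (h : system R m).
Local Notation C := (Cplx R).
Implicit Types (x y : 'rV[C]_(1 + m)).

Definition sysgrad x : 'M[C]_(1 + m, m) := \matrix_(l, j) mgrad (h j) l x.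

(** The interior of the domain of convergence in quantitative form: the majorants stay bounded when
    every coordinate is enlarged by [d]. It is meant for points with nonnegative entries, where
    [reC] gives the modulus. *)
Definition bounded_beyond x (d : R) := forall j, exists B, forall N,
  boxsum (majorant (h j) (fun i => reC (x 0 i) + d)) N <= B.

Lemma sys_mapE x j : sys_map h x 0 j = msum (h j) x.
Proof. by rewrite mxE. Qed.

Lemma conv_dom_bounded_beyond x : conv_dom h x -> (forall i, 0 <= x 0 i) ->
  exists2 d, 0 < d & bounded_beyond x (d + d).
Proof.
move=> /nbhs_ballP[e /= e0 xe] x0.
have e0' := ltW e0; rewrite (ge0_toC e0') toC_gt0 in e0 xe.
pose d := reC e / 4%:R; have d0 : 0 < d by rewrite divr_gt0.
exists d => // j; pose y : 'rV[C]_(1 + m) := x + const_mx (toC (d + d)).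
have dd0 : 0 <= toC (d + d) by rewrite toC_ge0 addr_ge0 ?ltW.
have : ball x (toC (reC e)) y.
  rewrite -ball_normE/= opprD addrA subrr add0r normrN.
  apply: (@le_lt_trans _ _ (toC (d + d))).
    apply: mx_norm_le => // i k.
    by rewrite mxE ger0_norm.
  by rewrite lt_toC /d; lra.
move=> /xe/= /(_ j)/abs_cvgP[B hB]; exists B => N.
apply: le_trans (hB N); rewrite le_eqVlt; apply/orP; left; apply/eqP.
congr boxsum; congr majorant; apply/funext => i.
by rewrite !mxE ger0_norm ?addr_ge0// raddfD.
Qed.

Lemma bounded_beyond_mgrad_cvg x d j l : 0 < d -> (forall i, 0 <= x 0 i) ->
  bounded_beyond x d ->
  cvgn (boxsum (fun k => h j k * dmonomial k l (x 0))).
Proof.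
move=> d0 x0 xd; have [B hB] := xd j.
apply: (mgrad_cvg _ d0 hB) => i; first by rewrite reC_ge0.
by rewrite ger0_norm// -ge0_toC.
Qed.

Lemma bounded_beyond_msum_cvg x d j : 0 < d -> (forall i, 0 <= x 0 i) ->
  bounded_beyond x d ->
  cvgn (boxsum (fun k => h j k * monomial k (x 0))).
Proof.
move=> d0 x0 xd; have [B hB] := xd j.
apply: (msum_cvg hB) => i.
by rewrite ger0_norm// [leLHS]ge0_toC// le_toC lerDl ltW.
Qed.

(** One [d] of the margin covers the displacement of the base point, the other the increment: two
    points of the ball of radius [d / 2] are at distance at most [d]. Summing the bounds of all
    equations gives one constant for the maximum norm. *)
Lemma sys_quad_approx x0 d : 0 < d -> (forall i, 0 <= x0 0 i) ->
  bounded_beyond x0 (d + d) -> exists2 B : C, 0 <= B &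
  quad_approx (sys_map h) sysgrad x0 (toC (d / 2)) B.
Proof.
move=> d0 x00 /choice[B hB].
have B0 j : 0 <= B j.
  apply: le_trans (hB j 0%N); apply: boxsum_ge0 => k; apply: majorant_ge0 => i.
  by rewrite addr_ge0 ?reC_ge0// ltW// addr_gt0.
exists (toC ((\sum_j B j) / d ^+ 2)).
  by rewrite toC_ge0 divr_ge0 ?sumr_ge0// exprn_ge0// ltW.
move=> x y xd yd.
have yx : `|y - x| <= toC d.
  have -> : y - x = (y - x0) - (x - x0) by rewrite opprB addrA subrK.
  apply: le_trans (ler_normB _ _) _.
  by rewrite (splitr d) rmorphD/= lerD// ltW.
have xr i : `|x 0 i| <= toC (reC (x0 0 i) + d).
  have -> : x 0 i = x0 0 i + (x - x0) 0 i by rewrite !mxE [RHS]addrC subrK.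
  apply: le_trans (ler_normD _ _) _; rewrite rmorphD/= lerD//.
    by rewrite ger0_norm// -ge0_toC.
  apply: le_trans (ler_entry_norm _ _ _) _; apply: le_trans (ltW xd) _.
  by rewrite le_toC; lra.
apply: mx_norm_le => [|i j].
  by rewrite mulr_ge0 ?exprn_ge0// toC_ge0 divr_ge0 ?sumr_ge0// exprn_ge0// ltW.
rewrite (ord1 i) !mxE.
have -> : \sum_j0 (y - x) 0 j0 * sysgrad x j0 j =
    \sum_l (y - x) 0 l * mgrad (h j) l x.
  by apply: eq_bigr => l _; rewrite !mxE.
have hBj N : boxsum (majorant (h j) (fun i => (reC (x0 0 i) + d) + d)) N <= B j.
  apply: le_trans (hB j N); rewrite le_eqVlt; apply/orP; left; apply/eqP.
  by congr boxsum; congr majorant; apply/funext => k; rewrite addrA.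
apply: le_trans (msum_quad _ d0 hBj xr yx) _.
  by move=> k; rewrite addr_ge0 ?reC_ge0// ltW.
rewrite ler_wpM2r ?exprn_ge0// le_toC ler_wpM2r ?invr_ge0 ?exprn_ge0 ?(ltW d0)//.
by rewrite (bigD1 j)//= lerDl sumr_ge0.
Qed.

Lemma dHdUE x j l : conv_dom h x -> (forall i, 0 <= x 0 i) ->
  dHdU h x j l = mgrad (h j) (rshift 1 l) x.
Proof.
move=> xc x0; have [d d0 xd] := conv_dom_bounded_beyond xc x0.
have [B B0 q] := sys_quad_approx d0 x0 xd.
rewrite /dHdU (quad_approx_jacobian B0 q); last first.
  by rewrite subrr normr0 toC_gt0 divr_gt0.
by rewrite !mxE.
Qed.

Lemma sys_map_ge0 x d j : 0 < d -> (forall j k, 0 <= h j k) ->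
  (forall i, 0 <= x 0 i) -> bounded_beyond x d -> 0 <= sys_map h x 0 j.
Proof.
move=> d0 h0 x0 xd; rewrite sys_mapE msumE.
have c : cvgn (boxsum (fun k => h j k * monomial k (x 0))).
  exact: bounded_beyond_msum_cvg xd.
apply: (@cvgC_ge0 _ _ _ 0%N c) => N _.
by apply: sumr_ge0 => k _; rewrite mulr_ge0 ?monomial_ge0.
Qed.

Lemma mgrad_ge0 x d j l : 0 < d -> (forall j k, 0 <= h j k) ->
  (forall i, 0 <= x 0 i) -> bounded_beyond x d -> 0 <= mgrad (h j) l x.
Proof.
move=> d0 h0 x0 xd.
have c : cvgn (boxsum (fun k => h j k * dmonomial k l (x 0))).
  exact: bounded_beyond_mgrad_cvg xd.
rewrite /mgrad; apply: (@cvgC_ge0 _ _ _ 0%N c) => N _.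
by apply: sumr_ge0 => k _; rewrite mulr_ge0 ?dmonomial_ge0.
Qed.

Lemma mgrad_gt0 x d j l (k : {ffun 'I_(1 + m) -> nat}) : 0 < d ->
  (forall j k, 0 <= h j k) -> (forall i, 0 < x 0 i) -> bounded_beyond x d ->
  (0 < k l)%N -> h j k != 0 -> 0 < mgrad (h j) l x.
Proof.
move=> d0 h0 x0 xd kl hjk; have x0' i := ltW (x0 i).
have : h j k * dmonomial k l (x 0) <= mgrad (h j) l x.
  apply: (@boxsum_term_le_lim _ _ (fun k => h j k * dmonomial k l (x 0))).
    by move=> k'; rewrite mulr_ge0 ?dmonomial_ge0.
  exact: bounded_beyond_mgrad_cvg xd.
by apply: lt_le_trans; rewrite mulr_gt0 ?dmonomial_gt0// lt_def hjk h0.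
Qed.

(** The remainder is a limit of nonnegative sums by [monomial_convex]. The margin is taken at the
    larger point [y], which already dominates [x], so the increment may have any size. *)
Lemma msum_convex x y d j : 0 < d -> (forall j k, 0 <= h j k) ->
  (forall i, 0 <= x 0 i) -> (forall i, x 0 i <= y 0 i) -> bounded_beyond y d ->
  \sum_l (y - x) 0 l * mgrad (h j) l x <= msum (h j) y - msum (h j) x.
Proof.
move=> d0 h0 x0 xy yd; have [B hB] := yd j.
have y0 i : 0 <= y 0 i by apply: le_trans (xy i).
rewrite -subr_ge0.
have := @msum_remainder_cvg _ _ _ _ _ _ _ d0 hB x y.
have h1 i : 0 <= reC (y 0 i) by rewrite reC_ge0.
have h2 i : `|x 0 i| <= toC (reC (y 0 i)).
  by rewrite ger0_norm// -ge0_toC.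
have h3 i : `|y 0 i| <= toC (reC (y 0 i) + d).
  by rewrite ger0_norm// [leLHS]ge0_toC// le_toC lerDl ltW.
move=> /(_ h1 h2 h3) rem; apply: (@cvgC_ge0 _ _ _ 0%N rem) => N _.
apply: sumr_ge0 => k' _; rewrite mulr_ge0//.
set k := [ffun _ => _].
have := @monomial_convex _ C (x 0) ((y - x) 0) x0 _ k.
have -> : (fun i => x 0 i + (y - x) 0 i) = y 0.
  by apply/funext => i; rewrite !mxE [LHS]addrC subrK.
by apply => i; rewrite !mxE subr_ge0.
Qed.

(** A single monomial involving the coordinate [l] gives the strict gain. Convergence at both points
    is enough, with no margin, so that the lemma can serve to prove interiority. *)
Lemma msum_lt x y j l (k : {ffun 'I_(1 + m) -> nat}) :
  (forall j k, 0 <= h j k) -> (forall i, 0 < x 0 i) ->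
  (forall i, x 0 i <= y 0 i) ->
  cvgn (boxsum (fun k => h j k * monomial k (x 0))) ->
  cvgn (boxsum (fun k => h j k * monomial k (y 0))) ->
  (0 < k l)%N -> h j k != 0 -> x 0 l < y 0 l ->
  msum (h j) x < msum (h j) y.
Proof.
move=> h0 x0 xy xc yc kl hjk xyl; have x0' i := ltW (x0 i).
have yxc : boxsum (fun k => h j k * (monomial k (y 0) - monomial k (x 0))) N
    @[N --> \oo] --> msum (h j) y - msum (h j) x.
  have -> : boxsum (fun k => h j k * (monomial k (y 0) - monomial k (x 0))) =
      fun N => boxsum (fun k => h j k * monomial k (y 0)) N
             - boxsum (fun k => h j k * monomial k (x 0)) N.
    apply/funext => N; rewrite -boxsumB.
    by apply: eq_boxsum => k'; rewrite mulrBr.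
  by rewrite (msumE _ y) (msumE _ x); exact: cvg_seqB yc xc.
rewrite -subr_gt0 -(cvg_lim _ yxc)//.
apply: lt_le_trans (@boxsum_term_le_lim _ _
  (fun k => h j k * (monomial k (y 0) - monomial k (x 0))) k _ _).
- by rewrite mulr_gt0 ?subr_gt0 ?(lt_monomial kl)// lt_def hjk h0.
- by move=> k'; rewrite mulr_ge0 ?subr_ge0 ?le_monomial.
- exact: cvgP yxc.
Qed.

End SystemExpansion.

(** * Orders of vanishing at 0 along the positive reals *)

Section BigO.
Variable R : realType.
Implicit Types f g : R -> R.

(** One-sided, since values are compared only at small positive reals. The bound carries no absolute
    value because it is applied to functions that are nonnegative there. *)
Definition bigO_at0 (n : nat) f := exists K e : R,
  [/\ 0 < e, 0 <= K & forall x, 0 < x < e -> f x <= K * x ^+ n].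

Definition near0 (P : R -> Prop) := exists2 e : R, 0 < e &
  forall x, 0 < x < e -> P x.

Lemma near0_and P Q : near0 P -> near0 Q -> near0 (fun x => P x /\ Q x).
Proof.
move=> [e e0 he] [d d0 hd]; exists (Num.min e d); first by rewrite lt_min e0.
move=> x; rewrite lt_min => /and3P[x0 xe xd].
by split; [apply: he|apply: hd]; rewrite x0.
Qed.

Lemma near0_imp (P Q : R -> Prop) :
  (forall x, 0 < x -> P x -> Q x) -> near0 P -> near0 Q.
Proof.
move=> PQ [e e0 he]; exists e => // x /[dup] /andP[x0 _] /he; exact: PQ.
Qed.

Lemma near0_lt e : 0 < e -> near0 (fun x => x < e).
Proof. by move=> e0; exists e => // x /andP[]. Qed.

Lemma bigO_le n f g : near0 (fun x => f x <= g x) -> bigO_at0 n g -> bigO_at0 n f.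
Proof.
move=> fg [K [e [e0 K0 he]]].
have [d d0 hd] := near0_and fg (ex_intro2 _ _ e e0 he).
exists K, d; split=> // x /hd[fgx]; exact: le_trans.
Qed.

Lemma bigO_add n f g : bigO_at0 n f -> bigO_at0 n g ->
  bigO_at0 n (fun x => f x + g x).
Proof.
move=> [K [e [e0 K0 he]]] [L [d [d0 L0 hd]]].
have [c c0 hc] := near0_and (ex_intro2 _ _ e e0 he) (ex_intro2 _ _ d d0 hd).
exists (K + L), c; split; rewrite ?addr_ge0// => x /hc[h1 h2].
by rewrite mulrDl lerD.
Qed.

Lemma bigO_mul n p f g : (forall x, 0 <= f x) -> (forall x, 0 <= g x) ->
  bigO_at0 n f -> bigO_at0 p g -> bigO_at0 (n + p) (fun x => f x * g x).
Proof.
move=> f0 g0 [K [e [e0 K0 he]]] [L [d [d0 L0 hd]]].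
have [c c0 hc] := near0_and (ex_intro2 _ _ e e0 he) (ex_intro2 _ _ d d0 hd).
exists (K * L), c; split; rewrite ?mulr_ge0// => x /hc[h1 h2].
by rewrite exprD mulrACA ler_pM.
Qed.

Lemma bigO_weaken n p f : (n <= p)%N -> bigO_at0 p f -> bigO_at0 n f.
Proof.
move=> np [K [e [e0 K0 he]]].
have [c c0 hc] := near0_and (ex_intro2 _ _ e e0 he) (near0_lt ltr01).
exists K, c; split=> // x /[dup] /andP[x0 _] /hc[fx x1].
apply: le_trans fx _; rewrite ler_wpM2l//.
by rewrite ler_wiXn2l// ltW.
Qed.

Lemma bigO_scale n c f : 0 <= c -> bigO_at0 n f -> bigO_at0 n (fun x => c * f x).
Proof.
move=> c0 [K [e [e0 K0 he]]]; exists (c * K), e; split; rewrite ?mulr_ge0//.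
by move=> x /he fx; rewrite -mulrA ler_wpM2l.
Qed.

Lemma bigO_near_lt n f e : (0 < n)%N -> bigO_at0 n f -> 0 < e ->
  near0 (fun x => f x < e).
Proof.
move=> n0 /(bigO_weaken n0)[K [d [d0 K0 hd]]] e0.
have K10 : 0 < K + 1 by rewrite ltr_wpDl.
have := near0_and (ex_intro2 _ _ d d0 hd) (near0_lt (divr_gt0 e0 K10)).
apply: near0_imp => x x0 [fx]; rewrite ltr_pdivlMr// => xe.
by apply: le_lt_trans fx _; apply: le_lt_trans xe; rewrite expr1; nra.
Qed.

Lemma bigO_cst (c : R) n : bigO_at0 n.+1 (fun x => `|c| * x ^+ n) -> c = 0.
Proof.
move=> [K [e [e0 K0 he]]]; apply/eqP; rewrite -normr_le0.
apply/ler_addgt0Pr => d d0; rewrite add0r.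
have K10 : 0 < K + 1 by rewrite ltr_wpDl.
pose x := Num.min (e / 2) (d / (K + 1)).
have x0 : 0 < x by rewrite lt_min !divr_gt0.
have xe : x < e by rewrite gt_min ltr_pdivrMr// ltr_pMr// ltr1n.
have := he x; rewrite x0 xe => /(_ erefl).
rewrite exprS mulrA ler_pM2r ?exprn_gt0// => /le_trans; apply.
apply: (@le_trans _ _ ((K + 1) * (d / (K + 1)))).
  apply: ler_pM => //; [exact: ltW|by rewrite lerDl|].
  by rewrite /x ge_min lexx orbT.
by rewrite mulrC divfK ?gt_eqF.
Qed.

End BigO.

(** * Compositions with nonnegative polynomials *)

Section NonnegativePolynomials.
Variable R : realType.
Implicit Types (p q : {poly R}) (c : nat -> R).

Definition nnegp p := forall i, 0 <= p`_i.

Definition lep p q := nnegp (q - p).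

Lemma nnegpD p q : nnegp p -> nnegp q -> nnegp (p + q).
Proof. by move=> p0 q0 i; rewrite coefD addr_ge0. Qed.

Lemma nnegpM p q : nnegp p -> nnegp q -> nnegp (p * q).
Proof. by move=> p0 q0 i; rewrite coefM sumr_ge0// => j _; rewrite mulr_ge0. Qed.

Lemma nnegpZ a p : 0 <= a -> nnegp p -> nnegp (a *: p).
Proof. by move=> a0 p0 i; rewrite coefZ mulr_ge0. Qed.

Lemma nnegp0 : nnegp 0. Proof. by move=> i; rewrite coef0. Qed.

Lemma nnegp1 : nnegp 1. Proof. by move=> i; rewrite coef1 ler0n. Qed.

Lemma nnegpX : nnegp 'X. Proof. by move=> i; rewrite coefX ler0n. Qed.

Lemma nnegp_sum (I : finType) (P : pred I) (F : I -> {poly R}) :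
  (forall i, nnegp (F i)) -> nnegp (\sum_(i | P i) F i).
Proof.
move=> F0; elim/big_ind: _ => //; [exact: nnegp0|exact: nnegpD].
Qed.

Lemma lepp p : lep p p. Proof. by rewrite /lep subrr; exact: nnegp0. Qed.

Lemma lep_coef p q i : lep p q -> p`_i <= q`_i.
Proof. by move=> /(_ i); rewrite coefB subr_ge0. Qed.

Lemma lep_nneg p q : nnegp p -> lep p q -> nnegp q.
Proof. by move=> p0 pq; rewrite -(subrK p q); exact: nnegpD. Qed.

Lemma lepM p q r s : nnegp p -> nnegp r -> lep p q -> lep r s ->
  lep (p * r) (q * s).
Proof.
move=> p0 r0 pq rs.
have -> : q * s = p * r + ((q - p) * s + p * (s - r)) by ring.
rewrite /lep addrAC subrr add0r; apply: nnegpD; apply: nnegpM => //.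
exact: lep_nneg rs.
Qed.

Lemma nnegp_monomial n (k : {ffun 'I_n -> nat}) (P : 'I_n -> {poly R}) :
  (forall i, nnegp (P i)) -> nnegp (monomial k P).
Proof.
move=> P0; rewrite /monomial; elim/big_ind: _ => [||i _].
- exact: nnegp1.
- exact: nnegpM.
- by elim: (k i) => [|j IH]; rewrite ?expr0 ?exprS; [exact: nnegp1|exact: nnegpM].
Qed.

Lemma lep_monomial n (k : {ffun 'I_n -> nat}) (P Q : 'I_n -> {poly R}) :
  (forall i, nnegp (P i)) -> (forall i, lep (P i) (Q i)) ->
  lep (monomial k P) (monomial k Q).
Proof.
move=> P0 PQ.
suff [] : nnegp (monomial k P) /\ lep (monomial k P) (monomial k Q) by [].
rewrite /monomial; elim/big_ind2: _.
- by split; [exact: nnegp1|exact: lepp].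
- by move=> p q r s [p0 pq] [r0 rs]; split; [exact: nnegpM|exact: lepM].
- move=> i _; elim: (k i) => [|j [h1 h2]].
    by rewrite !expr0; split; [exact: nnegp1|exact: lepp].
  by rewrite !exprS; split; [exact: nnegpM|exact: lepM].
Qed.

Definition psum c (x : R) M : R := \sum_(n < M) c n * x ^+ n.

Lemma psum_homo c x M N : (forall n, 0 <= c n) -> 0 <= x -> (M <= N)%N ->
  psum c x M <= psum c x N.
Proof.
move=> c0 x0 MN; rewrite /psum -!(big_mkord xpredT (fun n => c n * x ^+ n)).
rewrite (@big_cat_nat _ _ _ M 0 N)//= lerDl.
by apply: sumr_ge0 => i _; rewrite mulr_ge0 ?exprn_ge0.
Qed.

Lemma psum_ge0 c x M : (forall n, 0 <= c n) -> 0 <= x -> 0 <= psum c x M.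
Proof. by move=> c0 x0; apply: sumr_ge0 => i _; rewrite mulr_ge0 ?exprn_ge0. Qed.

Lemma horner_psum p x : exists M0, forall M, (M0 <= M)%N ->
  p.[x] = psum (fun n => p`_n) x M.
Proof. by exists (size p) => M pM; rewrite (horner_coef_wide _ pM). Qed.

Lemma psum_le_horner p x M : nnegp p -> 0 <= x ->
  psum (fun n => p`_n) x M <= p.[x].
Proof.
move=> p0 x0; have [M0 h] := horner_psum p x.
by rewrite (h (maxn M0 M)) ?leq_maxl// psum_homo ?leq_maxr.
Qed.

Lemma nnegp_horner p x : nnegp p -> 0 <= x -> 0 <= p.[x].
Proof. by move=> p0 x0; apply: le_trans (psum_le_horner 0 p0 x0); rewrite psum_ge0. Qed.

Lemma lep_horner p q x : lep p q -> 0 <= x -> p.[x] <= q.[x].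
Proof.
by move=> pq x0; rewrite -subr_ge0 -hornerN -hornerD; exact: nnegp_horner.
Qed.

(** Coefficients are bounded because the values at [x0] are, hence converge to some [c], and the
    suprema over [N] and over [M] can be exchanged. Equality of the two suprema is expressed through
    their upper bounds, so that it also makes sense where they are infinite. *)
Lemma limit_coefficients (g : nat -> {poly R}) (x0 B : R) :
  (forall N, nnegp (g N)) -> (forall N M, (N <= M)%N -> lep (g N) (g M)) ->
  0 < x0 -> (forall N, (g N).[x0] <= B) ->
  exists2 c : nat -> R, forall n, 0 <= c n & forall x, 0 <= x -> forall y,
    (forall N, (g N).[x] <= y) <-> (forall M, psum c x M <= y).
Proof.
move=> g0 gle x00 gB.
have gc n : cvgn (fun N => (g N)`_n).
  apply: nondecreasing_is_cvgn; first by move=> N M NM; exact: lep_coef (gle _ _ NM).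
  exists (B / x0 ^+ n) => _ [N _ <-]; rewrite ler_pdivlMr ?exprn_gt0//.
  apply: le_trans (gB N); apply: le_trans (psum_le_horner n.+1 (g0 N) (ltW x00)).
  rewrite /psum big_ord_recr/= lerDr; apply: sumr_ge0 => i _.
  by apply: mulr_ge0; [exact: g0|exact: exprn_ge0 (ltW x00)].
pose c n := limn (fun N => (g N)`_n).
have gcle N n : (g N)`_n <= c n.
  apply: (nondecreasing_cvgn_le (u_ := fun N => (g N)`_n)) => // M1 M2 M12.
  exact: lep_coef (gle _ _ M12).
exists c => [n|x xge0 y]; first exact: le_trans (g0 0%N n) (gcle 0%N n).
split=> [gy M|cy N]; last first.
  have [M0 h] := horner_psum (g N) x; rewrite (h M0)//.
  apply: le_trans (cy M0); apply: ler_sum => i _.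
  by rewrite ler_wpM2r ?exprn_ge0.
have hc : psum (fun n => (g N)`_n) x M @[N --> \oo] --> psum c x M.
  apply: cvg_seq_sum => i; under eq_fun do rewrite mulrC.
  by rewrite mulrC; apply: cvg_seqMl; exact: gc.
rewrite -(cvg_lim _ hc)//; apply: limr_le; first exact: cvgP hc.
by exists 0%N => // N _ /=; apply: le_trans (gy N); exact: psum_le_horner.
Qed.

Section Composition.
Variables (n : nat) (a : {ffun 'I_n -> nat} -> R) (Q : nat -> 'I_n -> {poly R}).
Hypotheses (a_ge0 : forall k, 0 <= a k) (Q_ge0 : forall N i, nnegp (Q N i)).
Hypothesis Q_homo : forall N M i, (N <= M)%N -> lep (Q N i) (Q M i).

(** Outer series and inner sequences are cut off at the same index, so that one monotone limit
    replaces the composition of power series. *)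
Definition polycomp N : {poly R} := boxsum (fun k => a k *: monomial k (Q N)) N.

Lemma nnegp_polycomp N : nnegp (polycomp N).
Proof. by apply: nnegp_sum => k; apply: nnegpZ => //; exact: nnegp_monomial. Qed.

Lemma polycomp_homo N M : (N <= M)%N -> lep (polycomp N) (polycomp M).
Proof.
move=> NM; rewrite /lep /polycomp (boxsum_split _ NM) addrAC; apply: nnegpD.
  rewrite /boxsum -sumrB; apply: nnegp_sum => k; rewrite -scalerBr.
  by apply: nnegpZ => //; apply: lep_monomial => // i; exact: Q_homo.
by apply: nnegp_sum => k; apply: nnegpZ => //; exact: nnegp_monomial.
Qed.

Lemma horner_polycomp N x : (polycomp N).[x] =
  boxsum (fun k => a k * monomial k (fun i => (Q N i).[x])) N.
Proof.
rewrite /polycomp /boxsum horner_sum; apply: eq_bigr => k _.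
rewrite hornerZ; congr (_ * _); rewrite /monomial horner_prod.
by apply: eq_bigr => i _; rewrite horner_exp.
Qed.

Lemma cvg_monomial (s : 'I_n -> nat -> R) (q : 'I_n -> R) k :
  (forall i, s i N @[N --> \oo] --> q i) ->
  monomial k (fun i => s i N) @[N --> \oo] --> monomial k q.
Proof.
move=> sq; have sX i j : s i N ^+ j @[N --> \oo] --> q i ^+ j.
  elim: j => [|j IH]; first by under eq_fun do rewrite expr0; exact: cvg_cst.
  by under eq_fun do rewrite exprS; rewrite exprS; apply: cvgM.
rewrite /monomial unlock; elim: (index_enum _) => [|i r IH] /=.
  exact: cvg_cst.
by apply: cvgM => //; exact: sX.
Qed.

(** Exchange of suprema along the diagonal: for a fixed box [N] the inner limit is reached through
    indices [M] beyond [N], and each such value lies below the diagonal term of index [M]. *)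
Lemma polycomp_same_sup x (q : 'I_n -> R) : 0 <= x ->
  (forall i, (Q N i).[x] @[N --> \oo] --> q i) -> forall y,
  (forall N, boxsum (fun k => a k * monomial k q) N <= y) <->
  (forall N, (polycomp N).[x] <= y).
Proof.
move=> x0 Qq y.
have Q0 N i : 0 <= (Q N i).[x] by exact: nnegp_horner.
have Qle N i : (Q N i).[x] <= q i.
  rewrite -(cvg_lim _ (Qq i))//.
  apply: (nondecreasing_cvgn_le (u_ := fun N => (Q N i).[x])).
    by move=> M1 M2 M12; apply: lep_horner => //; exact: Q_homo.
  exact: cvgP (Qq i).
split=> h N.
  apply: le_trans (h N); rewrite horner_polycomp; apply: le_boxsum => k.
  by rewrite ler_wpM2l// le_monomial.
have hc : boxsum (fun k => a k * monomial k (fun i => (Q M i).[x])) N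
    @[M --> \oo] --> boxsum (fun k => a k * monomial k q) N.
  by apply: cvg_seq_sum => k; apply: cvg_seqMl; exact: cvg_monomial.
rewrite -(cvg_lim _ hc)//; apply: limr_le; first exact: cvgP hc.
exists N => // M /= NM; apply: le_trans (h M); rewrite horner_polycomp.
by apply: boxsum_homo NM => k; rewrite mulr_ge0 ?monomial_ge0.
Qed.

(** The point is that one sequence [c] serves every [x]: a bound at the single point [x0] yields the
    coefficients of the composition, valid wherever the inner sequences converge. *)
Lemma polycomp_coefficients x0 B : 0 < x0 -> (forall N, (polycomp N).[x0] <= B) ->
  exists2 c : nat -> R, forall j, 0 <= c j &
    forall x (q : 'I_n -> R), 0 <= x ->
    (forall i, (Q N i).[x] @[N --> \oo] --> q i) -> forall y,
    (forall N, boxsum (fun k => a k * monomial k q) N <= y) <->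
    (forall M, psum c x M <= y).
Proof.
move=> x00 hB; have [c c0 hc] :=
  limit_coefficients nnegp_polycomp polycomp_homo x00 hB.
exists c => // x q xge0 Qq y; rewrite -hc//; exact: polycomp_same_sup.
Qed.

End Composition.

(** In degree i >= n one has c_i x^i <= (x / e)^n c_i e^i, so the tail at [x] is at most (x / e)^n
    times the sum at [e]. *)
Lemma psum_tail c (e B x s : R) n : (forall j, 0 <= c j) -> 0 < e ->
  (forall M, psum c e M <= B) -> 0 <= x <= e ->
  (forall y, (forall M, psum c x M <= y) <-> s <= y) ->
  `|psum c x n - s| <= B / e ^+ n * x ^+ n.
Proof.
move=> c0 e0 cB /andP[x0 xe] hs.
have psM M : psum c x M <= s by move: M; apply/hs.
rewrite distrC ger0_norm ?subr_ge0// lerBlDl; apply/hs => M.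
have B0 : 0 <= B by apply: le_trans (cB 0%N); rewrite psum_ge0// ltW.
have r0 : 0 <= B / e ^+ n * x ^+ n.
  by rewrite mulr_ge0 ?divr_ge0 ?exprn_ge0 ?(ltW e0).
have [Mn|nM] := leqP M n.
  by apply: le_trans (psum_homo c0 x0 Mn) _; rewrite lerDl.
rewrite /psum -!(big_mkord xpredT (fun n => c n * x ^+ n)).
rewrite (@big_cat_nat _ _ _ n 0 M)//=; last exact: ltnW.
rewrite lerD2l.
apply: (@le_trans _ _ (psum c e M / e ^+ n * x ^+ n)); last first.
  by rewrite ler_wpM2r ?exprn_ge0// ler_wpM2r// invr_ge0 exprn_ge0// ltW.
rewrite /psum -(big_mkord xpredT (fun n => c n * e ^+ n)).
rewrite [in leRHS](@big_cat_nat _ _ _ n 0 M)//=; last exact: ltnW.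
rewrite -mulrA mulrDl.
apply: (@le_trans _ _ ((\sum_(n <= i < M) c i * e ^+ i) * (e ^- n * x ^+ n))).
  rewrite mulr_suml [leLHS]big_nat [leRHS]big_nat.
  apply: ler_sum => i /andP[ni _]; rewrite -mulrA ler_wpM2l//.
  rewrite mulrA -(subnK ni) !exprD mulfK ?expf_neq0 ?gt_eqF//.
  by rewrite ler_wpM2r ?exprn_ge0// lerXn2r// nnegrE ltW.
rewrite lerDr mulr_ge0 ?mulr_ge0 ?invr_ge0 ?exprn_ge0 ?(ltW e0)//.
by apply: sumr_ge0 => i _; rewrite mulr_ge0 ?exprn_ge0 ?(ltW e0).
Qed.

Lemma poly_bounded p : bigO_at0 0 (fun x => `|p.[x]|).
Proof.
exists (\sum_(i < size p) `|p`_i|), 1; split=> //; first by rewrite sumr_ge0.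
move=> x /andP[x0 x1]; rewrite expr0 mulr1 horner_coef.
apply: le_trans (ler_norm_sum _ _ _) _; apply: ler_sum => i _.
rewrite normrM ler_piMr// ger0_norm ?exprn_ge0 ?(ltW x0)//.
by rewrite exprn_ile1// ltW.
Qed.

(** The constant term is O(x), hence 0, and a factor X can be divided out. This is the identity
    principle by which coefficients are compared. *)
Lemma poly_bigO_coef p n : bigO_at0 n (fun x => `|p.[x]|) ->
  forall i, (i < n)%N -> p`_i = 0.
Proof.
elim/poly_ind: p n => [|p c IH] n hp i; first by rewrite coef0.
case: n hp => // n hp i_n.
have pE x : (p * 'X + c%:P).[x] = p.[x] * x + c by rewrite !hornerE.
have c0 : c = 0.
  apply: (@bigO_cst _ c 0).
  have h1 : bigO_at0 1 (fun x => `|p.[x]| * `|x|).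
    have := @bigO_mul R 0 1 (fun x => `|p.[x]|) (fun x => `|x|) _ _ (poly_bounded p).
    apply=> //; exists 1, 1; split=> // x /andP[x0 _].
    by rewrite expr1 mul1r gtr0_norm.
  have h2 := bigO_add (bigO_weaken (ltn0Sn n) hp) h1.
  apply: bigO_le h2; exists 1 => // x _; rewrite expr0 mulr1 pE -normrM.
  by rewrite (le_trans _ (ler_normB _ _))// [X in `|X - _|]addrC addrK.
rewrite c0 addr0 in hp pE *; rewrite coefMX; case: i i_n => //= i i_n.
apply: (IH n) => //; have [K [e [e0 K0 he]]] := hp.
exists K, e; split=> // x /[dup] xe /he; have /andP[x0 _] := xe.
by rewrite pE addr0 normrM (gtr0_norm x0) exprSr mulrA ler_pM2r.
Qed.

End NonnegativePolynomials.

(** * Coefficients of the solution *)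

Lemma mx11_scalar_entry (K : pzRingType) (z : K) (i j : 'I_1) :
  (z%:M : 'M[K]_1) i j = z.
Proof. by rewrite !ord1 mxE eqxx mulr1n. Qed.

Section Points.
Variables (R : realType) (m : nat).
Local Notation C := (Cplx R).

Lemma zU_point_l (z : C) (v : 'rV[C]_m) i : zU_point z v 0 (lshift m i) = z.
Proof. by rewrite row_mxEl mx11_scalar_entry. Qed.

Lemma zU_point_r (z : C) (v : 'rV[C]_m) j : zU_point z v 0 (rshift 1 j) = v 0 j.
Proof. by rewrite row_mxEr. Qed.

Lemma zU_point_all (P : C -> Prop) (z : C) (v : 'rV[C]_m) :
  P z -> (forall j, P (v 0 j)) -> forall i, P (zU_point z v 0 i).
Proof.
move=> Pz Pv i; case: (split_ordP i) => k ->.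
  by rewrite zU_point_l.
by rewrite zU_point_r.
Qed.

Lemma zU_pointB (z w : C) (v u : 'rV[C]_m) :
  zU_point z v - zU_point w u = zU_point (z - w) (v - u).
Proof.
by rewrite /zU_point opp_row_mx add_row_mx raddfB.
Qed.

Lemma norm_zU_point (z : C) (v : 'rV[C]_m) e :
  0 <= e -> `|z| <= e -> `|v| <= e -> `|zU_point z v| <= e.
Proof.
move=> e0 ze ve; apply: mx_norm_le => // i j; rewrite (ord1 i).
apply: (@zU_point_all (fun c => `|c| <= e)) => // k.
by apply: le_trans (ler_entry_norm _ _ _) ve.
Qed.

End Points.

(** [T] is the truncation, [G] the solution, [c] the power x^n, and [Hx], [Hy] are the values of H
    at [T] and [G]. The terms on the right are the tail past degree n, the second-order remainder at
    the truncation, the variation of the gradient, and the tail times [A]; each is O(x^(n+1)). *)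
Lemma expansion_algebra (K : comNzRingType) p m (T G Hy Hx u : 'rV[K]_m) (c : K)
    (E : 'rV[K]_p) (L1 L0 : 'M[K]_(p, m)) (A : 'M[K]_m) :
  E *m L0 = (G - T) *m A -> Hy = G ->
  T + c *: (u - u *m A) - Hx =
  - (G - (T + c *: u)) + (Hy - Hx - E *m L1) +
  (E *m (L1 - L0) + (G - (T + c *: u)) *m A).
Proof.
move=> EL ->; rewrite mulmxBr EL !mulmxBl mulmxDl -scalemxAl scalerBr.
by apply/rowP => j; rewrite !mxE; ring.
Qed.

Section SolutionExpansion.
Variables (R : realType) (m : nat) (h : system R m) (U : gf R m).
Local Notation C := (Cplx R).
Hypotheses (wf : well_founded_system h) (sol : gf_solution h U).

Definition nrm p (v : 'rV[C]_p) : R := reC `|v|.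

Lemma toC_nrm p (v : 'rV[C]_p) : toC (nrm v) = `|v|.
Proof. by rewrite -mx_normCE. Qed.

Lemma nrm_ge0 p (v : 'rV[C]_p) : 0 <= nrm v.
Proof. exact: reC_ge0. Qed.

Lemma ler_nrmD p (u v : 'rV[C]_p) : nrm (u + v) <= nrm u + nrm v.
Proof. by rewrite -le_toC rmorphD/= !toC_nrm ler_normD. Qed.

Lemma nrmN p (v : 'rV[C]_p) : nrm (- v) = nrm v.
Proof. by rewrite /nrm normrN. Qed.

Definition ucoef n : 'rV[C]_m := \row_j U j n.

Definition gf_trunc n (x : R) : 'rV[C]_m := \sum_(k < n) toC (x ^+ k) *: ucoef k.

Lemma gf_truncE n x j : gf_trunc n x 0 j = \sum_(k < n) U j k * toC x ^+ k.
Proof.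
rewrite /gf_trunc summxE; apply: eq_bigr => k _.
by rewrite !mxE rmorphXn/= mulrC.
Qed.

Lemma gf_truncS n x : gf_trunc n.+1 x = gf_trunc n x + toC (x ^+ n) *: ucoef n.
Proof. by rewrite /gf_trunc big_ord_recr. Qed.

Lemma wf_iter_ge0 k j : (k <= m)%N -> 0 <= wf_iter h k 0 j.
Proof.
have [_ h0 hc _] := wf.
elim: k j => [|k IH] j km; first by rewrite mxE.
have x0 i : 0 <= zU_point 0 (wf_iter h k) 0 i.
  by apply: (@zU_point_all _ _ (fun c => 0 <= c)) => // l; exact: IH (ltnW km).
have [d d0 xd] := conv_dom_bounded_beyond (hc k (ltnW km)) x0.
exact: sys_map_ge0 (addr_gt0 d0 d0) h0 x0 xd.
Qed.

Lemma near0_of_nearC (P : C -> Prop) :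
  (\forall z \near (0 : C), P z) -> near0 (fun x : R => P (toC x)).
Proof.
move=> /nbhs_ballP[e /= e0 he]; have e0' := ltW e0.
rewrite (ge0_toC e0') toC_gt0 in e0 he.
exists (reC e) => // x /andP[x0 xe]; apply: he.
by rewrite -ball_normE/= sub0r normrN norm_toC lt_toC gtr0_norm.
Qed.

Lemma series_terms_bounded (s : nat -> C) : cvgn (series s) ->
  exists2 K : R, 0 <= K & forall n, reC `|s n| <= K.
Proof.
move=> /cvgrPdist_lt/(_ 1 ltr01)[N _ hN].
pose b : R := \sum_(k < N) reC `|s k|.
have b0 : 0 <= b by apply: sumr_ge0 => k _; rewrite reC_ge0.
exists (2 + b) => [|n]; first by rewrite addr_ge0.
have [Nn|nN] := leqP N n; last first.
  rewrite /b (bigD1 (Ordinal nN))//= addrCA lerDl addr_ge0// sumr_ge0// => k _.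
  exact: (@reC_ge0 _ `|s k|).
apply: (@le_trans _ _ 2); last by rewrite lerDl.
rewrite -le_toC -normCE.
have -> : s n = (limn (series s) - series s n) - (limn (series s) - series s n.+1).
  have -> : series s n.+1 = series s n + s n by rewrite /series/= big_nat_recr.
  by move: (limn _) (series s n) (s n) => a b' c; ring.
apply: le_trans (ler_normB _ _) _; rewrite rmorph_nat.
rewrite -[2]/(1 + 1); apply: lerD; apply: ltW; apply: hN => //=.
exact: leqW.
Qed.

Lemma sol_coef_bound : exists x1 K : R, [/\ 0 < x1, 0 <= K &
  forall j n, reC `|U j n| * x1 ^+ n <= K].
Proof.
have [/near0_of_nearC[e e0 he] _ _] := sol.
have x10 : 0 < e / 2 by rewrite divr_gt0.
have xe : 0 < e / 2 < e by rewrite x10/= ltr_pdivrMr// ltr_pMr// ltr1n.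
have /= c := he _ xe.
have hK j : exists K : R, 0 <= K /\ forall n, reC `|U j n| * (e / 2) ^+ n <= K.
  have [K K0 hK] := series_terms_bounded (c j).
  exists K; split=> // n; apply: le_trans (hK n).
  rewrite normrM normrX norm_toC (gtr0_norm x10) -rmorphXn.
  by rewrite [X in _ <= reC X]mulrC reC_toCM [leRHS]mulrC.
have /choice[K KP] := hK.
exists (e / 2), (\sum_j K j); split=> // [|j n].
  by apply: sumr_ge0 => j _; have [] := KP j.
have [_ /(_ n)] := KP j; move/le_trans; apply.
by rewrite (bigD1 j)//= lerDl sumr_ge0// => j' _; have [] := KP j'.
Qed.

Lemma geometric_tail (q : R) n N : 0 <= q -> q <= 1 / 2 ->
  \sum_(n <= k < N) q ^+ k <= 2 * q ^+ n.
Proof.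
move=> q0 q2; have [Nn|nN] := leqP N n.
  by rewrite big_geq// mulr_ge0 ?exprn_ge0.
suff : \sum_(n <= k < N) q ^+ k <= 2 * q ^+ n - 2 * q ^+ N.
  by move=> /le_trans; apply; rewrite gerBl mulr_ge0 ?exprn_ge0.
elim: N nN => // N IH; rewrite ltnS => nN.
rewrite big_nat_recr//=; move: nN; rewrite leq_eqVlt => /orP[/eqP <-|/IH hN].
  rewrite big_geq// add0r exprS.
  have : 0 <= q ^+ n by rewrite exprn_ge0.
  by nra.
rewrite exprS; have : 0 <= q ^+ N by rewrite exprn_ge0.
by nra.
Qed.

Lemma gf_tail n : bigO_at0 n (fun x => nrm (gf_val U (toC x) - gf_trunc n x)).
Proof.
have [x1 [K [x10 K0 hK]]] := sol_coef_bound.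
have [/near0_of_nearC[e e0 he] _ _] := sol.
exists (K * 2 / x1 ^+ n), (Num.min e (x1 / 2)); split.
- by rewrite lt_min e0 divr_gt0.
- by rewrite divr_ge0 ?mulr_ge0 ?exprn_ge0 ?(ltW x10).
move=> x; rewrite lt_min => /and3P[x0 xe xx1].
rewrite -le_toC toC_nrm; apply: mx_norm_le => [|i j].
  by rewrite toC_ge0 mulr_ge0 ?exprn_ge0 ?(ltW x0)// divr_ge0 ?mulr_ge0 ?exprn_ge0 ?(ltW x10).
rewrite (ord1 i) [X in `|X|]mxE [X in `|_ + X|]mxE gf_truncE mxE.
have /(_ j) c : gf_cvg U (toC x) by apply: he; rewrite x0.
apply: (@cvgC_norm_le _ _ _ _ _ n c) => N nN.
rewrite /series/= -(big_mkord xpredT (fun k => U j k * toC x ^+ k)).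
rewrite (@big_cat_nat _ _ _ n 0 N)//= [X in `|X|]addrC addKr.
apply: le_trans (ler_norm_sum _ _ _) _.
pose q := x / x1.
have q0 : 0 <= q by rewrite divr_ge0 ?ltW.
have q2 : q <= 1 / 2 by rewrite ler_pdivrMr// mulrC mulrA mulr1 ltW.
apply: (@le_trans _ _ (\sum_(n <= k < N) toC (K * q ^+ k))).
  apply: ler_sum => k _; rewrite normrM normrX norm_toC (gtr0_norm x0).
  rewrite [`|U j k|]normCE -rmorphXn/= -rmorphM/= le_toC /q expr_div_n.
  have xk : 0 < x1 ^+ k by rewrite exprn_gt0.
  rewrite mulrA ler_pdivlMr// mulrAC ler_wpM2r ?exprn_ge0 ?(ltW x0)//.
  exact: hK.
rewrite -rmorph_sum/= le_toC -mulr_sumr.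
apply: (@le_trans _ _ (K * (2 * q ^+ n))); first by rewrite ler_wpM2l// geometric_tail.
by rewrite /q expr_div_n le_eqVlt; apply/orP; left; apply/eqP; ring.
Qed.

Lemma gf_val0 : gf_val U 0 = ucoef 0.
Proof.
apply/rowP => j; rewrite !mxE; apply: (@lim_near_cst C) => //.
exists 1%N => // N /= N1; rewrite /series/= big_ltn// expr0 mulr1.
by rewrite big_nat big1 ?addr0// => k /andP[k1 _]; rewrite expr0n gtn_eqF// mulr0.
Qed.

Lemma ucoef0 : ucoef 0 = wf_iter h m.
Proof. by have [_ _ <-] := sol; rewrite gf_val0. Qed.

Lemma gf_trunc1 x : gf_trunc 1 x = wf_iter h m.
Proof. by rewrite /gf_trunc big_ord1 expr0 rmorph1 scale1r ucoef0. Qed.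

Definition wf_point : 'rV[C]_(1 + m) := zU_point 0 (wf_iter h m).

Lemma wf_point_ge0 i : 0 <= wf_point 0 i.
Proof.
apply: (@zU_point_all _ _ (fun c => 0 <= c)) => // j.
exact: wf_iter_ge0 (leqnn m).
Qed.

Lemma conv_dom_wf_point : conv_dom h wf_point.
Proof. by have [_ _ /(_ m (leqnn m))] := wf. Qed.

Lemma bigO_gf1 : bigO_at0 1 (fun x => nrm (gf_val U (toC x) - wf_iter h m)).
Proof. by have := gf_tail 1; apply: bigO_le; exists 1 => // x _; rewrite gf_trunc1. Qed.

Lemma bigO_trunc n : (0 < n)%N ->
  bigO_at0 1 (fun x => nrm (gf_trunc n x - wf_iter h m)).
Proof.
move=> n0; have := bigO_add bigO_gf1 (bigO_weaken n0 (gf_tail n)).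
apply: bigO_le; exists 1 => // x _.
rewrite -[X in _ <= _ + X]nrmN; apply: le_trans (ler_nrmD _ _).
by rewrite opprB [X in _ <= nrm X]addrC addrA subrK.
Qed.

Lemma bigO_zU (f : R -> 'rV[C]_m) v : bigO_at0 1 (fun x => nrm (f x - v)) ->
  bigO_at0 1 (fun x => nrm (zU_point (toC x) (f x) - zU_point 0 v)).
Proof.
move=> hf; have hx : bigO_at0 1 (fun x : R => x).
  by exists 1, 1; split=> // x _; rewrite expr1 mul1r.
apply: bigO_le (bigO_add hx hf); exists 1 => // x /andP[x0 _].
rewrite zU_pointB subr0 -le_toC toC_nrm; apply: norm_zU_point.
- by rewrite toC_ge0 addr_ge0 ?nrm_ge0// ltW.
- by rewrite norm_toC le_toC gtr0_norm// lerDl nrm_ge0.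
- by rewrite -toC_nrm le_toC lerDr ltW.
Qed.

(** Expand H around the truncation and use U = H(z, U). The tail [D] is O(x^n); the quadratic
    remainder is O(x^(2n)), which suffices because n > 0; replacing the gradient at the truncation
    by the one at [wf_point] costs O(x) times [D]. The conclusion says that u - u A is the n-th
    Taylor coefficient of H along the truncation. *)
Lemma sol_coef_equation n : (0 < n)%N -> bigO_at0 n.+1 (fun x => nrm
  (gf_trunc n x + toC (x ^+ n) *: (ucoef n - ucoef n *m dsubmx (sysgrad h wf_point))
   - sys_map h (zU_point (toC x) (gf_trunc n x)))).
Proof.
move=> n0.
have [d d0 xd] := conv_dom_bounded_beyond conv_dom_wf_point wf_point_ge0.
have [B B0 q] := sys_quad_approx d0 wf_point_ge0 xd.
have d20 : 0 < toC (d / 2) by rewrite toC_gt0 divr_gt0.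
have [_ /near0_of_nearC hsol _] := sol.
pose X x := zU_point (toC x) (gf_trunc n x).
pose Y x := zU_point (toC x) (gf_val U (toC x)).
pose D x := gf_val U (toC x) - gf_trunc n x.
have YX x : Y x - X x = zU_point 0 (D x) by rewrite zU_pointB subrr.
have nD x : nrm (Y x - X x) <= nrm (D x).
  rewrite YX -le_toC !toC_nrm; apply: norm_zU_point => //.
  by rewrite normr0.
(* Half of the radius of the expansion, since [quad_approx_lipschitz] asks for twice the distance to
   stay inside. *)
pose r := d / 2 / 2; have r0 : 0 < r by rewrite !divr_gt0.
have rr : r + r = d / 2 by rewrite -splitr.
have OX := bigO_zU (bigO_trunc n0).
have nX := bigO_near_lt (ltn0Sn 0) OX r0.
have nY := bigO_near_lt (ltn0Sn 0) (bigO_zU bigO_gf1) r0.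
have O1 : bigO_at0 n.+1 (fun x => nrm (gf_val U (toC x) - gf_trunc n.+1 x)).
  exact: gf_tail.
have O2 : bigO_at0 n.+1 (fun x => reC B * (nrm (D x) * nrm (D x))).
  apply: bigO_scale; first exact: reC_ge0.
  apply: bigO_weaken (bigO_mul _ _ (gf_tail n) (gf_tail n)).
  - by rewrite -addn1 leq_add2l.
  - by move=> x; exact: nrm_ge0.
  - by move=> x; exact: nrm_ge0.
have O3 : bigO_at0 n.+1 (fun x => reC (6%:R * B) *
    (nrm (X x - wf_point) * nrm (D x))).
  apply: bigO_scale; first by rewrite reC_ge0// mulr_ge0.
  by apply: (@bigO_mul _ 1 n _ _ _ _ OX (gf_tail n)) => x; exact: nrm_ge0.
pose A := dsubmx (sysgrad h wf_point).
have O4 : bigO_at0 n.+1 (fun x => reC (m%:R * `|A|) *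
    nrm (gf_val U (toC x) - gf_trunc n.+1 x)).
  by apply: bigO_scale O1; rewrite reC_ge0// mulr_ge0.
apply: bigO_le (bigO_add (bigO_add O1 O2) (bigO_add O3 O4)).
have := near0_and hsol (near0_and nX nY).
apply: near0_imp => x x0 [[_ sx] [Xr Yr]].
have B0' := ge0_toC B0.
have nXt : `|X x - wf_point| < toC r by rewrite -toC_nrm lt_toC.
have nYt : `|Y x - wf_point| < toC r by rewrite -toC_nrm lt_toC.
have rd : toC r < toC (d / 2) by rewrite lt_toC -rr ltrDl.
have E2 : nrm (sys_map h (Y x) - sys_map h (X x) - (Y x - X x) *m sysgrad h (X x))
    <= reC B * (nrm (D x) * nrm (D x)).
  rewrite -le_toC toC_nrm; apply: le_trans (q _ _ _ _) _.
  - exact: lt_trans nXt rd.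
  - exact: lt_trans nYt rd.
  rewrite rmorphM/= -B0' ler_wpM2l// rmorphM/= -expr2 lerXn2r// ?nnegrE//.
    by rewrite toC_ge0 nrm_ge0.
  by rewrite -toC_nrm le_toC.
have E3 : nrm ((Y x - X x) *m (sysgrad h (X x) - sysgrad h wf_point))
    <= reC (6%:R * B) * (nrm (X x - wf_point) * nrm (D x)).
  rewrite -le_toC toC_nrm; apply: le_trans (quad_approx_lipschitz d20 B0 q _ _) _.
    by rewrite -rr rmorphD/= ltrD.
  rewrite rmorphM/= -ge0_toC ?mulr_ge0// rmorphM/= toC_nrm mulrA ler_wpM2l//.
    by rewrite !mulr_ge0.
  by rewrite -toC_nrm le_toC.
have E4 : nrm ((gf_val U (toC x) - gf_trunc n.+1 x) *m A) <=
    reC (m%:R * `|A|) * nrm (gf_val U (toC x) - gf_trunc n.+1 x).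
  rewrite -le_toC toC_nrm; apply: le_trans (ler_norm_mulmx _ _) _.
  by rewrite rmorphM/= -ge0_toC ?mulr_ge0// toC_nrm.
apply: le_trans (lerD (lerD (lexx _) E2) (lerD E3 E4)).
rewrite -[X in _ <= X + _ + _]nrmN.
apply: le_trans (lerD (ler_nrmD _ _) (ler_nrmD _ _)).
apply: le_trans (ler_nrmD _ _).
rewrite le_eqVlt; apply/orP; left; apply/eqP; congr nrm.
have DA : (Y x - X x) *m sysgrad h wf_point = D x *m A.
  rewrite YX /zU_point -[in LHS](vsubmxK (sysgrad h wf_point)) mul_row_col.
  by rewrite raddf0 mul0mx add0r.
rewrite gf_truncS.
exact: (@expansion_algebra _ _ _ (gf_trunc n x) (gf_val U (toC x))
  (sys_map h (Y x)) (sys_map h (X x)) (ucoef n) (toC (x ^+ n)) (Y x - X x)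
  (sysgrad h (X x)) (sysgrad h wf_point) A DA (esym sx)).
Qed.

End SolutionExpansion.

(** * Sums at nonnegative real points as suprema *)

Definition zU_fun m (T : Type) (x : T) (q : 'I_m -> T) (i : 'I_(1 + m)) : T :=
  match fintype.split i with inl _ => x | inr j => q j end.

Lemma zU_fun_all m (T : Type) (P : T -> Prop) x (q : 'I_m -> T) :
  P x -> (forall j, P (q j)) -> forall i, P (zU_fun x q i).
Proof. by move=> Px Pq i; rewrite /zU_fun; case: fintype.split. Qed.

Lemma zU_fun_rshift m (T : Type) x (q : 'I_m -> T) j : zU_fun x q (rshift 1 j) = q j.
Proof. by rewrite /zU_fun (unsplitK (inr j)). Qed.

Lemma cvg_sup (R : realType) (s : nat -> R) (l : R) :
  (forall N M, (N <= M)%N -> s N <= s M) -> s N @[N --> \oo] --> l ->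
  forall y, (forall N, s N <= y) <-> l <= y.
Proof.
move=> sh sl y; split=> [sy|ly N].
  rewrite -(cvg_lim _ sl)//; apply: limr_le; first exact: cvgP sl.
  by exists 0%N.
apply: le_trans ly; rewrite -(cvg_lim _ sl)//.
by apply: (nondecreasing_cvgn_le (u_ := s)) => //; exact: cvgP sl.
Qed.

Lemma sup_cvg (R : realType) (s : nat -> R) (l : R) :
  (forall N M, (N <= M)%N -> s N <= s M) ->
  (forall y, (forall N, s N <= y) <-> l <= y) -> s N @[N --> \oo] --> l.
Proof.
move=> sh hl.
have sl N : s N <= l by move: N; apply/hl.
have sc : cvgn s.
  by apply: nondecreasing_is_cvgn => //; exists l => _ [N _ <-].
suff -> : l = limn s by [].
apply/eqP; rewrite eq_le; apply/andP; split.
  by apply/hl => N; exact: nondecreasing_cvgn_le.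
by apply: limr_le => //; exists 0%N.
Qed.

Lemma reC_affine (R : realType) (a b s : R) (z : Cplx R) :
  reC (toC a + toC b * z - toC s) = a + b * reC z - s.
Proof. by case: z => u v; rewrite /reC/= mul0r subr0. Qed.

Section RealPoints.
Variables (R : realType) (m : nat) (h : system R m).
Local Notation C := (Cplx R).
Hypothesis h_ge0 : forall j k, 0 <= h j k.
Implicit Types (x : 'rV[C]_(1 + m)) (X : 'I_(1 + m) -> R).

Definition hreal j k : R := reC (h j k).

Lemma hreal_ge0 j k : 0 <= hreal j k. Proof. exact: reC_ge0. Qed.

Lemma boxsum_real j x X : (forall i, x 0 i = toC (X i)) ->
  boxsum (fun k => h j k * monomial k (x 0)) =
  fun N => toC (boxsum (fun k => hreal j k * monomial k X) N).
Proof.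
move=> xX; apply/funext => N; rewrite toC_boxsum; apply: eq_boxsum => k.
rewrite rmorphM/= -ge0_toC// toC_monomial; congr (_ * monomial k _).
exact/funext.
Qed.

(** With [sup_msum] this translates between complex sums at nonnegative real points and suprema of
    real box sums: here convergence is given, there it is concluded. *)
Lemma msum_sup j x X : (forall i, x 0 i = toC (X i)) -> (forall i, 0 <= X i) ->
  cvgn (boxsum (fun k => h j k * monomial k (x 0))) ->
  msum (h j) x = toC (reC (msum (h j) x)) /\
  forall y, (forall N, boxsum (fun k => hreal j k * monomial k X) N <= y) <->
    reC (msum (h j) x) <= y.
Proof.
move=> xX X0; rewrite msumE (boxsum_real j xX) => /[dup] c /cvgC_reC cr.
have pos k : 0 <= hreal j k * monomial k X.
  by rewrite mulr_ge0 ?hreal_ge0 ?monomial_ge0.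
split.
  apply: ge0_toC; apply: (@cvgC_ge0 _ _ _ 0%N c) => N _.
  by rewrite toC_ge0; apply: boxsum_ge0.
by apply: cvg_sup => // N M NM; exact: boxsum_homo.
Qed.

Lemma sup_msum j x X s : (forall i, x 0 i = toC (X i)) -> (forall i, 0 <= X i) ->
  (forall y, (forall N, boxsum (fun k => hreal j k * monomial k X) N <= y) <->
    s <= y) ->
  abs_cvg (h j) x /\ msum (h j) x = toC s.
Proof.
move=> xX X0 hs.
have pos k : 0 <= hreal j k * monomial k X.
  by rewrite mulr_ge0 ?hreal_ge0 ?monomial_ge0.
split.
  apply/abs_cvgP; exists s => N.
  have [_ /(_ (lexx s) N)] := hs s; apply: le_trans; apply: le_boxsum => k.
  rewrite /majorant ger0_norm// ler_wpM2l ?hreal_ge0//.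
  apply: le_monomial => i; first by rewrite reC_ge0.
  by rewrite xX norm_toC toCK ger0_norm.
rewrite msumE (boxsum_real j xX); apply: cvg_lim => //; apply: cvgC_toC.
by apply: sup_cvg => // N M NM; exact: boxsum_homo.
Qed.

Lemma zU_point_fun (x : R) (v : 'rV[C]_m) (q : 'I_m -> R) :
  (forall j, v 0 j = toC (q j)) ->
  forall i, zU_point (toC x) v 0 i = toC (zU_fun x q i).
Proof.
move=> vq i; rewrite /zU_fun; case: (split_ordP i) => k ->.
  by rewrite zU_point_l.
by rewrite zU_point_r vq.
Qed.

Lemma msum_no_z j z w (v : 'rV[C]_m) :
  (forall k : {ffun 'I_(1 + m) -> nat}, (0 < k (lshift m ord0))%N -> h j k = 0) ->
  msum (h j) (zU_point z v) = msum (h j) (zU_point w v).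
Proof.
move=> hz; rewrite !msumE; congr (limn _); apply/funext => N.
apply: eq_boxsum => k; have [k0|/hz ->] := posnP (k (lshift m ord0)); last first.
  by rewrite !mul0r.
congr (_ * _); apply: eq_bigr => i _; case: (split_ordP i) => l ->.
  by rewrite (ord1 l) k0 !expr0.
by rewrite !zU_point_r.
Qed.

End RealPoints.

(** Iterating u = g + u A gives u = g + g A + ... + g A^(k-1) + u A^k. The last term vanishes for k
    = p, so u inherits nonnegativity, and vanishing, from g. *)
Lemma nilpotent_solve (K : numFieldType) m (A : 'M[K]_m) (u : 'rV[K]_m) p :
  A^T ^+ p = 0 -> (forall i j, 0 <= A i j) ->
  (forall j, 0 <= (u - u *m A) 0 j) ->
  (forall j, 0 <= u 0 j) /\ (u - u *m A = 0 -> u = 0).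
Proof.
move=> Ap A0 g0.
have AT k : A^T ^+ k = (A ^+ k)^T.
  elim: k => [|k IH]; first by rewrite !expr0 trmx1.
  by rewrite exprS IH exprSr -[RHS]/((A ^+ k *m A)^T) trmx_mul.
have {}Ap : A ^+ p = 0.
  by apply: trmx_inj; rewrite -AT Ap trmx0.
have A0' k i j : 0 <= (A ^+ k) i j.
  elim: k i j => [|k IH] i j; first by rewrite expr0 mxE ler0n.
  rewrite exprS -[A * A ^+ k]/(A *m A ^+ k) mxE.
  by apply: sumr_ge0 => l _; rewrite mulr_ge0.
have key k : exists2 w : 'rV[K]_m, forall j, 0 <= w 0 j &
    (u - u *m A = 0 -> w = 0) /\ u = w + u *m A ^+ k.
  elim: k => [|k [w w0 [wz uw]]].
    exists 0; first by move=> j; rewrite mxE.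
    by split=> //; rewrite expr0 mulmx1 add0r.
  exists (w + (u - u *m A) *m A ^+ k).
    move=> j; rewrite mxE addr_ge0// mxE; apply: sumr_ge0 => l _.
    by rewrite mulr_ge0.
  split; first by move=> /[dup] /wz -> ->; rewrite mul0mx addr0.
  rewrite exprS -[A * A ^+ k]/(A *m A ^+ k) mulmxA mulmxBl -addrA subrK.
  exact: uw.
have [w w0 [wz]] := key p; rewrite Ap mulmx0 addr0 => uw.
by split=> [j|g]; rewrite uw// wz.
Qed.

Section Coefficients.
Variables (R : realType) (m : nat) (h : system R m) (U : gf R m).
Local Notation C := (Cplx R).
Hypotheses (wf : well_founded_system h) (sol : gf_solution h U).

Let h_ge0 j k : 0 <= h j k. Proof. by have [_ ->] := wf. Qed.

Let A : 'M[C]_m := dsubmx (sysgrad h (wf_point h)).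

Lemma wf_gradE : A^T = dHdU h (wf_point h).
Proof.
apply/matrixP => j l; rewrite (dHdUE _ _ (conv_dom_wf_point wf)); last first.
  exact: wf_point_ge0 wf.
by rewrite !mxE.
Qed.

Lemma wf_grad_nilpotent : exists p, A^T ^+ p = 0.
Proof. by have [_ _ _ [p hp]] := wf; exists p; rewrite wf_gradE. Qed.

Lemma wf_grad_ge0 i j : 0 <= A i j.
Proof.
have [d d0 xd] := conv_dom_bounded_beyond (conv_dom_wf_point wf) (wf_point_ge0 wf).
rewrite !mxE; apply: mgrad_ge0 xd => //; first exact: addr_gt0.
exact: wf_point_ge0.
Qed.

Lemma bigO_entry n (f : R -> 'rV[C]_m) j : bigO_at0 n (fun x => nrm (f x)) ->
  bigO_at0 n (fun x => `|reC (f x 0 j)|) /\ bigO_at0 n (fun x => `|imC (f x 0 j)|).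
Proof.
move=> hf; have le x : reC `|f x 0 j| <= nrm (f x).
  exact: reC_le (ler_entry_norm _ _ _).
split; apply: bigO_le hf; exists 1 => // x _; apply: le_trans (le x).
  exact: ler_norm_reC.
exact: ler_norm_imC.
Qed.

Lemma near0_cvg_near_wf_point j (f : R -> 'rV[C]_m) :
  bigO_at0 1 (fun x => nrm (f x - wf_iter h m)) ->
  near0 (fun x => cvgn (boxsum
    (fun k => h j k * monomial k (zU_point (toC x) (f x) 0)))).
Proof.
move=> hf.
have [d d0 xd] := conv_dom_bounded_beyond (conv_dom_wf_point wf) (wf_point_ge0 wf).
have dd0 : 0 < d + d by rewrite addr_gt0.
have := bigO_near_lt (ltn0Sn 0) (bigO_zU hf) dd0.
apply: near0_imp => x x0 xdd; have [B hB] := xd j.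
apply: (msum_cvg hB) => i.
have -> : zU_point (toC x) (f x) 0 i = wf_point h 0 i +
    (zU_point (toC x) (f x) - wf_point h) 0 i.
  by rewrite !mxE [RHS]addrC subrK.
apply: le_trans (ler_normD _ _) _; rewrite rmorphD/=; apply: lerD.
  by rewrite ger0_norm ?wf_point_ge0// -ge0_toC// wf_point_ge0.
apply: le_trans (ler_entry_norm _ _ _) _.
by rewrite -toC_nrm le_toC ltW.
Qed.

(** The entry is the n-th coefficient [c n] of H_j along the truncation, a polynomial with
    nonnegative coefficients by induction. All other terms of [sol_coef_equation] are real, which
    forces the imaginary part of the entry to vanish. *)
Lemma sol_coef_step n j : (0 < n)%N -> (forall l k, (k < n)%N -> 0 <= U l k) ->
  0 <= (ucoef U n - ucoef U n *m A) 0 j.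
Proof.
move=> n0 U0; set g := _ - _.
pose P l := \poly_(k < n) reC (U l k).
have P0 l : nnegp (P l).
  by move=> i; rewrite coef_poly; case: ifP => // i_n; rewrite reC_ge0// U0.
have truncP x l : gf_trunc U n x 0 l = toC (P l).[x].
  rewrite gf_truncE horner_poly rmorph_sum; apply: eq_bigr => k _ /=.
  by rewrite rmorphM/= rmorphXn/= -ge0_toC// U0.
pose Q (N : nat) i := zU_fun 'X P i.
pose q (x : R) i := zU_fun x (fun l => (P l).[x]) i.
have Q0 N i : nnegp (Q N i) by apply: zU_fun_all => //; exact: nnegpX.
have Qh N M i : (N <= M)%N -> lep (Q N i) (Q M i) by move=> _; exact: lepp.
have Qq x i : (Q N i).[x] @[N --> \oo] --> q x i.
  by rewrite /Q /q /zU_fun; case: fintype.split => l; rewrite ?hornerX; exact: cvg_cst.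
pose a := hreal h j.
have a0 k : 0 <= a k by exact: hreal_ge0.
pose S x := reC (msum (h j) (zU_point (toC x) (gf_trunc U n x))).
have q0 x : 0 < x -> forall i, 0 <= q x i.
  move=> x0; apply: (@zU_fun_all _ _ (fun c => 0 <= c)); first exact: ltW.
  by move=> l; apply: nnegp_horner => //; exact: ltW.
have [e e0 he] : near0 (fun x => msum (h j) (zU_point (toC x) (gf_trunc U n x)) =
    toC (S x) /\ forall y, (forall N, boxsum (fun k => a k * monomial k (q x)) N <= y)
      <-> S x <= y).
  have := near0_cvg_near_wf_point j (bigO_trunc sol n0).
  apply: near0_imp => x x0; apply: msum_sup => //; last exact: q0.
  by apply: zU_point_fun => l; rewrite truncP.
pose x1 := e / 2; have x10 : 0 < x1 by rewrite divr_gt0.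
have x1e : 0 < x1 < e by rewrite x10/= ltr_pdivrMr// ltr_pMr// ltr1n.
have hB N : (polycomp a Q N).[x1] <= S x1.
  have [_ hs] := he _ x1e.
  by move: N; apply/(polycomp_same_sup a0 Q0 Qh (ltW x10) (Qq x1)); apply/hs.
have [c c0 hc] := polycomp_coefficients a0 Q0 Qh x10 hB.
have hS x : 0 < x < e -> forall y, (forall M, psum c x M <= y) <-> S x <= y.
  move=> /[dup] /andP[x0 _] /he[_ hs] y.
  by rewrite -hs; split=> h1; apply/(hc x _ (ltW x0) (Qq x)).
have O1 : bigO_at0 n.+1 (fun x => `|psum c x n.+1 - S x|).
  exists (S x1 / x1 ^+ n.+1), x1; split=> //.
    rewrite divr_ge0 ?exprn_ge0 ?(ltW x10)//.
    have /(_ (S x1))[_ /(_ (lexx _) 0%N)] := hS _ x1e.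
    by rewrite /psum big_ord0.
  move=> x /andP[x0 xx1]; apply: psum_tail => //.
  - have /(_ (S x1))[_ /(_ (lexx _))] := hS _ x1e; exact.
  - by rewrite (ltW x0) ltW.
  - apply: hS; rewrite x0; apply: lt_trans xx1 _.
    by case/andP: x1e.
have [hre him] := bigO_entry j (sol_coef_equation wf sol n0).
pose F x := gf_trunc U n x + toC (x ^+ n) *: g -
  sys_map h (zU_point (toC x) (gf_trunc U n x)).
have FE x : F x 0 j = toC (P j).[x] + toC (x ^+ n) * g 0 j -
    msum (h j) (zU_point (toC x) (gf_trunc U n x)).
  have E3 (u v w : 'rV[C]_m) : (u + v - w) 0 j = u 0 j + v 0 j - w 0 j.
    by rewrite !mxE.
  rewrite /F E3 truncP sys_mapE; congr (_ + _ - _).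
  exact: mxE.
have nS : near0 (fun x => msum (h j) (zU_point (toC x) (gf_trunc U n x)) = toC (S x)).
  by exists e => // x /he[].
have gim : imC (g 0 j) = 0.
  apply: (@bigO_cst _ _ n); apply: bigO_le him.
  apply: near0_imp nS => x x0 Sx; rewrite -/(F x) FE Sx !raddfB raddfD/=.
  rewrite imC_toCM add0r subr0 normrM mulrC ger0_norm//.
  by rewrite exprn_ge0// ltW.
have gre : reC (g 0 j) = c n.
  (* [P j] stops below degree n, so the coefficient of degree n in [p] is [c n - reC (g 0 j)]. *)
  pose p := (\poly_(k < n.+1) c k) - P j - reC (g 0 j) *: 'X^n.
  have Op : bigO_at0 n.+1 (fun x => `|p.[x]|).
    apply: bigO_le (bigO_add O1 hre); apply: near0_imp nS => x x0 Sx.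
    rewrite -/(F x) FE Sx -[X in _ <= _ + X]normrN.
    apply: le_trans (ler_normD _ _).
    rewrite reC_affine !hornerE [(\poly_(_ < _) _).[x]]horner_poly -/(psum c x n.+1).
    by rewrite le_eqVlt; apply/orP; left; apply/eqP; congr `|_|; ring.
  have := poly_bigO_coef Op (ltnSn n).
  rewrite !coefB coef_poly ltnSn coef_poly ltnn coefZ coefXn eqxx mulr1 subr0.
  by move/eqP; rewrite subr_eq0 => /eqP.
have -> : g 0 j = toC (c n) by apply: reC_imC_eq; rewrite ?gre ?gim.
by rewrite toC_ge0.
Qed.

Lemma sol_coef_ge0 n j : 0 <= U j n.
Proof.
elim/ltn_ind: n j => n IH j; have [->|n0] := posnP n.
  have -> : U j 0%N = ucoef U 0 0 j by rewrite mxE.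
  by rewrite (ucoef0 sol); exact: wf_iter_ge0.
have [p hp] := wf_grad_nilpotent.
have -> : U j n = ucoef U n 0 j by rewrite mxE.
have [h1 _] := nilpotent_solve hp wf_grad_ge0
  (fun j => sol_coef_step j n0 (fun l k kn => IH k kn l)).
exact: h1.
Qed.

(** By induction the truncation is the constant V^[m], which is fixed by H(z, .) for every z. The
    equation for the next coefficient is then u = u A, and nilpotency gives u = 0. *)
Lemma no_z_constant :
  (forall j (k : {ffun 'I_(1 + m) -> nat}), (0 < k (lshift m ord0))%N -> h j k = 0) ->
  forall n j, (0 < n)%N -> U j n = 0.
Proof.
move=> hz; elim/ltn_ind => n IH j n0.
have tr x : gf_trunc U n x = wf_iter h m.
  rewrite -(gf_trunc1 sol x); apply/rowP => l; rewrite !gf_truncE.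
  rewrite -(big_mkord xpredT (fun k => U l k * toC x ^+ k)) big_ltn//.
  rewrite big_nat big1 ?addr0 ?big_ord1//.
  by move=> k /andP[k0 kn]; rewrite IH ?mul0r.
have g0 : ucoef U n - ucoef U n *m A = 0.
  set g := _ - _; apply/rowP => l; rewrite [RHS]mxE.
  have [hre him] := bigO_entry l (sol_coef_equation wf sol n0).
  pose F x := gf_trunc U n x + toC (x ^+ n) *: g -
    sys_map h (zU_point (toC x) (gf_trunc U n x)).
  have FE x : F x 0 l = toC (x ^+ n) * g 0 l.
    have E3 (u v w : 'rV[C]_m) : (u + v - w) 0 l = u 0 l + v 0 l - w 0 l.
      by rewrite !mxE.
    rewrite /F E3 tr sys_mapE (msum_no_z _ 0 _ (hz l)) -sys_mapE.
    have [_ hs hV] := sol; have [_ ] := nbhs_singleton hs.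
    rewrite hV => <-; rewrite addrAC subrr add0r; exact: mxE.
  apply: reC_imC_eq; apply: (@bigO_cst _ _ n).
    apply: bigO_le hre; exists 1 => // x /andP[x0 _].
    rewrite -/(F x) FE reC_toCM normrM mulrC ger0_norm//.
    by rewrite exprn_ge0// ltW.
  apply: bigO_le him; exists 1 => // x /andP[x0 _].
  rewrite -/(F x) FE imC_toCM normrM mulrC ger0_norm//.
  by rewrite exprn_ge0// ltW.
have [p hp] := wf_grad_nilpotent.
have [|_ h2] := nilpotent_solve hp wf_grad_ge0 (u := ucoef U n).
  by move=> l; rewrite g0 mxE.
have -> : U j n = ucoef U n 0 j by rewrite mxE.
by rewrite h2// mxE.
Qed.

End Coefficients.

(** * Extension of the equation to the disc of convergence *)

Section Extension.
Variables (R : realType) (m : nat) (h : system R m) (U : gf R m).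
Local Notation C := (Cplx R).
Hypotheses (wf : well_founded_system h) (sol : gf_solution h U).

Let h_ge0 j k : 0 <= h j k. Proof. by have [_ ->] := wf. Qed.

Definition ureal (j : 'I_m) (n : nat) : R := reC (U j n).

Definition uval (x : R) (j : 'I_m) : R := limn (psum (ureal j) x).

Definition summable_at (x : R) := 0 <= x /\ forall j, exists B, forall N,
  psum (ureal j) x N <= B.

Lemma ureal_ge0 j n : 0 <= ureal j n.
Proof. exact: reC_ge0 (sol_coef_ge0 wf sol n j). Qed.

Lemma toC_ureal j n : toC (ureal j n) = U j n.
Proof. by rewrite -ge0_toC// (sol_coef_ge0 wf sol). Qed.

Lemma series_psum j x : series (fun n => U j n * toC x ^+ n) =
  fun N => toC (psum (ureal j) x N).
Proof.
apply/funext => N; rewrite /series/= /psum big_mkord rmorph_sum.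
by apply: eq_bigr => k _ /=; rewrite rmorphM/= rmorphXn/= toC_ureal.
Qed.

Lemma summable_le x y : summable_at y -> 0 <= x <= y -> summable_at x.
Proof.
move=> [y0 hy] /andP[x0 xy]; split=> // j; have [B hB] := hy j.
exists B => N; apply: le_trans (hB N); apply: ler_sum => k _.
by rewrite ler_wpM2l ?ureal_ge0// lerXn2r// nnegrE.
Qed.

Lemma summable_uval_cvg x j : summable_at x -> psum (ureal j) x N @[N --> \oo] --> uval x j.
Proof.
move=> [x0 /(_ j)[B hB]]; apply: nondecreasing_is_cvgn.
  by move=> N M NM; apply: psum_homo => // n; exact: ureal_ge0.
by exists B => _ [N _ <-].
Qed.

Lemma summable_uval_sup x j : summable_at x ->
  forall y, (forall M, psum (ureal j) x M <= y) <-> uval x j <= y.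
Proof.
move=> gx; apply: cvg_sup; last exact: summable_uval_cvg.
by move=> N M NM; apply: psum_homo => //; [exact: ureal_ge0|case: gx].
Qed.

Lemma uval_ge0 x j : summable_at x -> 0 <= uval x j.
Proof.
move=> gx; have /(_ (uval x j))[_ /(_ (lexx _) 0%N)] := summable_uval_sup j gx.
by rewrite /psum big_ord0.
Qed.

Lemma gf_val_uval x j : summable_at x -> gf_val U (toC x) 0 j = toC (uval x j).
Proof.
move=> gx; rewrite mxE series_psum; apply: cvg_lim => //; apply: cvgC_toC.
exact: summable_uval_cvg.
Qed.

Lemma summable_of_gf_cvg x : 0 <= x -> gf_cvg U (toC x) -> summable_at x.
Proof.
move=> x0 c; split=> // j; have := c j; rewrite series_psum => /cvgC_reC.
set l := limn _ => hl; exists (reC l).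
apply/(cvg_sup _ hl) => // N M NM; apply: psum_homo => // n.
exact: ureal_ge0.
Qed.

Lemma near0_summable : near0 summable_at.
Proof.
have [/near0_of_nearC hc _ _] := sol; apply: near0_imp hc => x x0.
exact: summable_of_gf_cvg (ltW x0).
Qed.

Lemma uval_tail j n : bigO_at0 n (fun x => `|psum (ureal j) x n - uval x j|).
Proof.
have [e e0 he] := near0_summable.
have x1e : 0 < e / 2 < e by rewrite divr_gt0//= ltr_pdivrMr// ltr_pMr// ltr1n.
have /andP[x10 xe] := x1e; have gx := he _ x1e.
exists (uval (e / 2) j / (e / 2) ^+ n), (e / 2); split=> //.
  by rewrite divr_ge0 ?uval_ge0 ?exprn_ge0 ?(ltW x10).
move=> x /andP[x0 xx1]; apply: psum_tail => //.
- exact: ureal_ge0.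
- by apply/(summable_uval_sup j gx).
- by rewrite (ltW x0) ltW.
- by apply: summable_uval_sup; apply: he; rewrite x0 (lt_trans xx1).
Qed.

Definition upoint x : 'rV[C]_(1 + m) := zU_point (toC x) (gf_val U (toC x)).

Lemma upointE x : summable_at x -> forall i, upoint x 0 i = toC (zU_fun x (uval x) i).
Proof. by move=> gx; apply: zU_point_fun => j; exact: gf_val_uval. Qed.

Lemma zU_fun_uval_ge0 x : summable_at x -> forall i, 0 <= zU_fun x (uval x) i.
Proof. 
by move=> gx; apply: (@zU_fun_all _ _ (fun c => 0 <= c)) => [|j];
  [case: gx|exact: uval_ge0].
 Qed.

(* The coefficients of the composition [H(z, U(z))] are limits of those of the
   polynomials obtained by truncating both [H] and [U]; near [0] they agree
   with those of [U], which propagates the equation to the whole disc. *)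
Lemma sol_extends x j : summable_at x ->
  abs_cvg (h j) (upoint x) /\ msum (h j) (upoint x) = toC (uval x j).
Proof.
pose P (N : nat) l := \poly_(k < N) ureal l k.
pose Q (N : nat) i := zU_fun 'X (P N) i.
pose a := hreal h j.
have a0 k : 0 <= a k by exact: hreal_ge0.
have P0 N l : nnegp (P N l).
  by move=> i; rewrite coef_poly; case: ifP => // _; exact: ureal_ge0.
have Q0 N i : nnegp (Q N i) by apply: zU_fun_all => //; exact: nnegpX.
have Qh N M i : (N <= M)%N -> lep (Q N i) (Q M i).
  move=> NM; rewrite /Q /zU_fun; case: fintype.split => l; first exact: lepp.
  move=> k; rewrite coefB !coef_poly; case: ifP => kM; case: ifP => kN.
  - by rewrite subrr.
  - by rewrite subr0 ureal_ge0.
  - by rewrite (leq_trans kN NM) in kM.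
  - by rewrite subrr.
have Qq y i : summable_at y -> (Q N i).[y] @[N --> \oo] --> zU_fun y (uval y) i.
  move=> gy; rewrite /Q /zU_fun; case: fintype.split => l.
    by rewrite hornerX; exact: cvg_cst.
  have -> : (fun N => (P N l).[y]) = psum (ureal l) y.
    by apply/funext => N; rewrite horner_poly.
  exact: summable_uval_cvg.
have [e e0 he] : near0 (fun y => summable_at y /\ forall z,
    (forall N, boxsum (fun k => a k * monomial k (zU_fun y (uval y))) N <= z)
      <-> uval y j <= z).
  have [_ /near0_of_nearC hs _] := sol.
  apply: near0_imp (near0_and near0_summable hs) => y y0 [gy [yc ye]].
  split=> //.
  have x0 i : 0 <= upoint y 0 i by rewrite upointE// toC_ge0 zU_fun_uval_ge0.
  have [d d0 xd] := conv_dom_bounded_beyond yc x0.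
  have c : cvgn (boxsum (fun k => h j k * monomial k (upoint y 0))).
    exact: bounded_beyond_msum_cvg (addr_gt0 d0 d0) x0 xd.
  have [_] := msum_sup h_ge0 (upointE gy) (zU_fun_uval_ge0 gy) c.
  have -> : msum (h j) (upoint y) = gf_val U (toC y) 0 j.
    rewrite -sys_mapE.
    exact: (congr1 (fun v : 'rV[C]_m => v 0 j) (esym ye)).
  by rewrite gf_val_uval.
pose x1 := e / 2; have x10 : 0 < x1 by rewrite divr_gt0.
have x1e : 0 < x1 < e by rewrite x10/= ltr_pdivrMr// ltr_pMr// ltr1n.
have hB N : (polycomp a Q N).[x1] <= uval x1 j.
  have [gx1 hs] := he _ x1e.
  move: N; apply/(polycomp_same_sup a0 Q0 Qh (ltW x10) (fun i => Qq x1 i gx1)).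
  exact/hs.
have [c c0 hc] := polycomp_coefficients a0 Q0 Qh x10 hB.
have hS y : 0 < y < e -> forall z, (forall M, psum c y M <= z) <-> uval y j <= z.
  move=> /[dup] /andP[y0 _] /he[gy hs] z.
  by rewrite -hs; split=> h1; apply/(hc y _ (ltW y0) (fun i => Qq y i gy)).
have cE n : c n = ureal j n.
  have O1 : bigO_at0 n.+1 (fun y => `|psum c y n.+1 - uval y j|).
    exists (uval x1 j / x1 ^+ n.+1), x1; split=> //.
      have [gx1 _] := he _ x1e.
      by rewrite divr_ge0 ?exprn_ge0 ?(ltW x10)// uval_ge0.
    move=> y /andP[y0 yx1]; apply: psum_tail => //.
    - have /(_ (uval x1 j))[_ /(_ (lexx _))] := hS _ x1e; exact.
    - by rewrite (ltW y0) ltW.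
    - apply: hS; rewrite y0; apply: lt_trans yx1 _.
      by case/andP: x1e.
  pose p := (\poly_(k < n.+1) c k) - (\poly_(k < n.+1) ureal j k).
  have Op : bigO_at0 n.+1 (fun y => `|p.[y]|).
    apply: bigO_le (bigO_add O1 (uval_tail j n.+1)); exists 1 => // y _.
    rewrite -[X in _ <= _ + X]normrN; apply: le_trans (ler_normD _ _).
    rewrite !hornerE !horner_poly opprB addrA subrK.
    exact: lexx.
  have := poly_bigO_coef Op (ltnSn n).
  by rewrite coefB !coef_poly ltnSn => /eqP; rewrite subr_eq0 => /eqP.
(* At an arbitrary summable [x] the equivalence is read in the other direction: the bound
   [uval U x j] proves that H_j converges at [upoint U x], besides giving the value. *)
move=> gx; apply: (sup_msum h_ge0 (upointE gx) (zU_fun_uval_ge0 gx)) => y.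
have [x0 _] := gx.
rewrite (hc x _ x0 (fun i => Qq x i gx)) -summable_uval_sup//.
have -> : c = ureal j by exact/funext.
by [].
Qed.

End Extension.

(** * Irreducible nonnegative systems *)

Lemma connect_closed (T : finType) (e : rel T) (P : T -> Prop) :
  (forall j k, e j k -> P j -> P k) -> forall j k, connect e j k -> P j -> P k.
Proof.
move=> eP j k /connectP[p]; elim: p j => [|l p IH] j /=; first by move=> _ ->.
by move=> /andP[ejl lp] kE Pj; apply: (IH l) => //; exact: eP ejl Pj.
Qed.

(* If the minimum [c] of [v / w] is not positive, then [v = c w] propagates
   along the edges, hence everywhere. *)
Lemma supersolution_sign (R : realType) m (M : 'I_m -> 'I_m -> R) (e : rel 'I_m)
    (w v : 'I_m -> R) :
  (forall j k, 0 <= M j k) -> (forall j k, e j k -> 0 < M j k) ->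
  (forall j k, connect e j k) -> (forall j, 0 < w j) ->
  (forall j, \sum_k M j k * w k <= w j) ->
  (exists j, \sum_k M j k * w k < w j) ->
  (forall j, \sum_k M j k * v k <= v j) ->
  (forall j, v j = 0) \/ (forall j, 0 < v j).
Proof.
move=> M0 eM ec w0 Mw [j1 Mw1] Mv.
pose j0 := [arg min_(j < j1) (v j / w j)]%O; pose c := v j0 / w j0.
have cle k : c * w k <= v k.
  rewrite -ler_pdivlMr// /c /j0; case: arg_minP => // k0 _; exact.
have cj0 : v j0 = c * w j0 by rewrite /c divfK ?gt_eqF.
have [cgt0|cle0] := ltP 0 c.
  by right=> j; apply: lt_le_trans (cle j); rewrite mulr_gt0.
(* As c <= 0, one has c w_j <= c (M w)_j <= (M v)_j <= v_j; when v_j = c w_j all of these are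
   equalities. *)
have chain j : v j = c * w j -> c * \sum_k M j k * w k = v j /\
    \sum_k M j k * (v k - c * w k) = 0.
  move=> vj.
  have E : \sum_k M j k * (v k - c * w k) =
      \sum_k M j k * v k - c * \sum_k M j k * w k.
    rewrite mulr_sumr -sumrB; apply: eq_bigr => k _; ring.
  have h1 : 0 <= \sum_k M j k * (v k - c * w k).
    by apply: sumr_ge0 => k _; rewrite mulr_ge0 ?subr_ge0.
  have h2 := Mv j; have h3 : c * w j <= c * \sum_k M j k * w k.
    by rewrite ler_wnM2l.
  rewrite E in h1 *; rewrite -vj in h3; lra.
have all_eq j : v j = c * w j.
  apply: (@connect_closed _ e (fun j => v j = c * w j)) (ec j0 j) cj0.
  move=> k l ekl /chain[_ /eqP]; rewrite psumr_eq0; last first.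
    by move=> k' _; rewrite mulr_ge0 ?subr_ge0.
  move=> /allP/(_ l (mem_index_enum _)); rewrite mulf_eq0 gt_eqF ?eM//=.
  by rewrite subr_eq0 => /eqP.
have [c0|cN0] := eqVneq c 0.
  by left=> j; rewrite all_eq c0 mul0r.
(* If v = c w with c nonzero, [chain] gives (M w)_j = w_j in every row, against the strict
   inequality at [j1]. *)
exfalso; have [h _] := chain _ (all_eq j1).
move: h; rewrite all_eq => /(mulfI cN0) h.
by rewrite h ltxx in Mw1.
Qed.

Lemma fin_positive_lower_bound (R : realType) n (f : 'I_n -> R) :
  (forall i, 0 < f i) -> exists2 d : R, 0 < d & forall i, d <= f i.
Proof.
(* The added 1 keeps the witness positive when n = 0. *)
move=> f0; exists (\sum_i (f i)^-1 + 1)^-1.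
  by rewrite invr_gt0 ltr_wpDl// sumr_ge0// => i _; rewrite invr_ge0 ltW.
move=> i; rewrite -[leRHS]invrK lef_pV2 ?posrE ?invr_gt0//.
  rewrite (bigD1 i)//= -addrA lerDl addr_ge0// sumr_ge0// => k _.
  by rewrite invr_ge0 ltW.
by rewrite ltr_wpDl// sumr_ge0// => k _; rewrite invr_ge0 ltW.
Qed.

(** * Radius of convergence and behaviour of the solution on the real interval *)

Section AbsoluteConvergence.
Variables (R : realType) (n : nat).
Local Notation C := (Cplx R).

Lemma abs_cvg_le (a : mcoefs R n) (x y : 'rV[C]_n) :
  (forall i, `|x 0 i| <= `|y 0 i|) -> abs_cvg a y -> abs_cvg a x.
Proof.
move=> xy /abs_cvgP[B hB]; apply/abs_cvgP; exists B => N.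
apply: le_trans (hB N); apply: le_boxsum => k; apply: le_majorant => i.
  by rewrite reC_ge0.
exact: reC_le.
Qed.

Lemma abs_cvg_msum (a : mcoefs R n) (x : 'rV[C]_n) : abs_cvg a x ->
  cvgn (boxsum (fun k => a k * monomial k (x 0))).
Proof.
move=> /abs_cvgP[B hB].
suff [] : cvgn (boxsum (fun k => a k * monomial k (x 0))) /\
  `|limn (boxsum (fun k => a k * monomial k (x 0)))| <= toC B by [].
apply: dominated_boxsum hB => k; rewrite normrM rmorphM/= -normCE.
rewrite ler_wpM2l// norm_monomial toC_monomial; apply: le_monomial => // i.
Qed.

End AbsoluteConvergence.

Lemma geometric_sum_le (R : realType) (q : R) N : 0 <= q < 1 ->
  \sum_(k < N) q ^+ k <= (1 - q)^-1.
Proof.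
move=> /andP[q0 q1]; have q10 : 0 < 1 - q by rewrite subr_gt0.
rewrite -(ler_pM2l q10) divff ?gt_eqF//.
suff -> : (1 - q) * \sum_(k < N) q ^+ k = 1 - q ^+ N.
  by rewrite gerBl exprn_ge0.
elim: N => [|N IH]; first by rewrite big_ord0 mulr0 expr0 subrr.
by rewrite big_ord_recr/= mulrDr IH exprS; ring.
Qed.

(* Convexity of [z ^+ n]: the chord slope on [x, y] is at most that on [r, s]. *)
Lemma exprB_le (R : realType) (x y r s : R) n : 0 <= x -> x <= y -> y <= r ->
  r < s -> y ^+ n - x ^+ n <= s ^+ n / (s - r) * (y - x).
Proof.
move=> x0 xy yr rs; have y0 := le_trans x0 xy; have r0 := le_trans y0 yr.
have s0 : 0 <= s by rewrite (le_trans r0)// ltW.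
have sr : 0 < s - r by rewrite subr_gt0.
rewrite mulrAC ler_pdivlMr// mulrC.
apply: (@le_trans _ _ ((s ^+ n - r ^+ n) * (y - x))); last first.
  by rewrite ler_wpM2r ?subr_ge0// gerBl exprn_ge0.
rewrite !subrXX -!mulrA ler_pM2l// [leRHS]mulrC ler_wpM2l ?subr_ge0//.
apply: ler_sum => i _; apply: ler_pM; rewrite ?exprn_ge0// lerXn2r ?nnegrE//.
  exact: le_trans yr (ltW rs).
exact: le_trans xy yr.
Qed.

Section Radius.
Variables (R : realType) (m : nat) (h : system R m) (U : gf R m).
Local Notation C := (Cplx R).
Hypotheses (wf : well_founded_system h) (sol : gf_solution h U).

Let u0 := ureal_ge0 wf sol.

(** Convergence at a complex z need not carry over to the real point |z|. Hence [s] is chosen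
    strictly between [t] and |z|, and the terms, bounded at z, are compared with a geometric series
    of ratio s / |z|. *)
Lemma summable_beyond (t : R) : 0 <= t -> (t%:E < conv_radius U)%E ->
  exists2 s, t < s & summable_at U s.
Proof.
move=> t0 /ereal_sup_gt[_ [z zc <-]]; rewrite lte_fin; set r := reC `|z| => tr.
have r0 : 0 < r by apply: le_lt_trans tr.
have [s ts sr] : exists2 s, t < s & s < r by exists ((t + r) / 2); lra.
have s0 : 0 <= s by rewrite (le_trans t0)// ltW.
exists s => //; split=> // j; have [K K0 hK] := series_terms_bounded (zc j).
have q1 : 0 <= s / r < 1 by rewrite divr_ge0 ?(ltW r0)//= ltr_pdivrMr// mul1r.
exists (K * (1 - s / r)^-1) => N.
apply: le_trans (ler_wpM2l K0 (geometric_sum_le N q1)).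
rewrite mulr_sumr; apply: ler_sum => k _; rewrite expr_div_n mulrA.
rewrite ler_pdivlMr ?exprn_gt0// mulrAC ler_wpM2r ?exprn_ge0//.
apply: le_trans (hK k); rewrite normrM normrX.
rewrite [`|U j k|]ger0_norm; last exact: sol_coef_ge0 wf sol _ _.
rewrite -(toC_ureal wf sol) reC_toCM [`|z|]normCE -/r -rmorphXn/=.
exact: lexx.
Qed.

Lemma uval_le x y j : summable_at U y -> 0 <= x <= y -> uval U x j <= uval U y j.
Proof.
move=> gy xy; have gx := summable_le wf sol gy xy; have /andP[x0 xy'] := xy.
apply/(summable_uval_sup wf sol j gx) => M.
have /(_ (uval U y j))[_ /(_ (lexx _) M)] := summable_uval_sup wf sol j gy.
apply: le_trans; apply: ler_sum => k _; rewrite ler_wpM2l//.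
by rewrite lerXn2r// nnegrE ?(le_trans x0).
Qed.

Lemma uval_lt x y j n : summable_at U y -> 0 <= x -> x < y -> (0 < n)%N ->
  0 < ureal U j n -> uval U x j < uval U y j.
Proof.
move=> gy x0 xy n0 un; have y0 : 0 <= y by rewrite (le_trans x0)// ltW.
have xy' : 0 <= x <= y by rewrite x0 ltW.
have gx := summable_le wf sol gy xy'.
pose d := ureal U j n * (y ^+ n - x ^+ n).
have d0 : 0 < d by rewrite mulr_gt0// subr_gt0 ltrXn2r ?nnegrE// -lt0n.
suff : uval U x j <= uval U y j - d by move=> /le_lt_trans; apply; rewrite gtrBl.
apply/(summable_uval_sup wf sol j gx) => M.
apply: (@le_trans _ _ (psum (ureal U j) x (maxn M n.+1))).
  by apply: psum_homo => //; rewrite leq_maxl.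
rewrite lerBrDr.
have /(_ (uval U y j))[_ /(_ (lexx _) (maxn M n.+1))] := summable_uval_sup wf sol j gy.
apply: le_trans; have nM : (n < maxn M n.+1)%N by rewrite leq_maxr.
rewrite /psum (bigD1 (Ordinal nM))//= [leRHS](bigD1 (Ordinal nM))//=.
rewrite addrAC /d mulrBr addrCA subrr addr0 lerD2l.
by apply: ler_sum => k _; rewrite ler_wpM2l// lerXn2r ?nnegrE// ltW.
Qed.

Lemma uval_gt0 x j n : summable_at U x -> 0 < x -> 0 < ureal U j n -> 0 < uval U x j.
Proof.
move=> gx x0 un.
have /(_ (uval U x j))[_ /(_ (lexx _) n.+1)] := summable_uval_sup wf sol j gx.
apply: lt_le_trans; rewrite /psum big_ord_recr/= ltr_wpDl//.
  exact: psum_ge0 (ltW x0).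
by rewrite mulr_gt0// exprn_gt0.
Qed.

Lemma uval_lipschitz r s j : summable_at U s -> 0 <= r -> r < s -> forall x y,
  0 <= x -> x <= y -> y <= r ->
  `|uval U y j - uval U x j| <= uval U s j / (s - r) * (y - x).
Proof.
move=> gs r0 rs x y x0 xy yr.
have y0 := le_trans x0 xy.
have gy : summable_at U y.
  by apply: (summable_le wf sol gs); rewrite y0/= (le_trans yr)// ltW.
have xy' : 0 <= x <= y by rewrite x0.
rewrite ger0_norm ?subr_ge0; last exact: uval_le.
rewrite lerBlDl.
apply/(summable_uval_sup wf sol j gy) => M.
have gx := summable_le wf sol gy xy'.
have /(_ (uval U x j))[_ /(_ (lexx _) M) hx] := summable_uval_sup wf sol j gx.
have /(_ (uval U s j))[_ /(_ (lexx _) M) hs] := summable_uval_sup wf sol j gs.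
have sr : 0 < s - r by rewrite subr_gt0.
apply: (@le_trans _ _ (psum (ureal U j) x M +
    psum (ureal U j) s M / (s - r) * (y - x))); last first.
  apply: lerD => //; rewrite ler_wpM2r ?subr_ge0// ler_wpM2r// invr_ge0.
  exact: ltW.
rewrite -lerBlDl /psum -sumrB -mulrA mulr_suml; apply: ler_sum => k _.
by rewrite -mulrBr -mulrA ler_wpM2l// mulrA; exact: exprB_le.
Qed.

Lemma uval_continuous r s j : summable_at U s -> 0 <= r -> r < s ->
  {within `[0, r], continuous (fun x => uval U x j)}.
Proof.
move=> gs r0 rs; apply/subspace_continuousP => x /=; rewrite in_itv/=.
move=> /andP[x0 xr]; apply/cvgrPdist_lt => e e0.
pose K := uval U s j / (s - r).
have K0 : 0 <= K.
  by rewrite divr_ge0 ?(uval_ge0 wf sol)// subr_ge0 ltW.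
have K10 : 0 < K + 1 by rewrite ltr_wpDl.
have near_x : \forall y \near nbhs (x : R), `|x - y| < e / (K + 1).
  apply/nbhs_ballP; exists (e / (K + 1)); first by rewrite /= divr_gt0.
  by move=> y; rewrite -ball_normE.
rewrite near_withinE; near=> y; rewrite /= in_itv/= => /andP[y0 yr].
have yx : `|x - y| < e / (K + 1) by near: y; exact: near_x.
apply: (@le_lt_trans _ _ (K * `|x - y|)); last first.
  apply: (@le_lt_trans _ _ ((K + 1) * `|x - y|)); first by rewrite ler_wpM2r ?lerDl.
  by rewrite mulrC -ltr_pdivlMr.
have [xy|/ltW yx'] := leP x y.
  rewrite distrC [`|x - y|]distrC [`|y - x|]ger0_norm ?subr_ge0//.
  exact: uval_lipschitz.
rewrite [`|x - y|]ger0_norm ?subr_ge0//.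
exact: uval_lipschitz.
Unshelve. all: by end_near. Qed.

Lemma uval0 j : uval U 0 j = ureal U j 0.
Proof.
apply: (@lim_near_cst R) => //; exists 1%N => // M /= M1.
rewrite /psum -(big_mkord xpredT (fun n => ureal U j n * 0 ^+ n)) big_ltn//.
rewrite expr0 mulr1 big_nat big1 ?addr0// => k /andP[k1 _].
by rewrite expr0n gtn_eqF// mulr0.
Qed.

Lemma conv_radius_gt0 : (0 < conv_radius U)%E.
Proof.
have [/near0_of_nearC[e e0 he] _ _] := sol.
have x1e : 0 < e / 2 < e by rewrite divr_gt0//= ltr_pdivrMr// ltr_pMr// ltr1n.
apply: lt_le_trans (ereal_sup_ubound _); last first.
  by exists (toC (e / 2)); [exact: he|reflexivity].
rewrite lte_fin norm_toC toCK; case/andP: x1e => x10 _.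
by rewrite gtr0_norm.
Qed.

Lemma value_at_radius_gt1 i : (1 < value_at_radius U i)%E -> exists r : R,
  [/\ 0 < r, (r%:E < conv_radius U)%E & 1 < uval U r i].
Proof.
rewrite /value_at_radius; set F := (X in lim X) => F1.
have rho0 := conv_radius_gt0.
(* A divergent filter would have the default value 0 as its limit, which is not above 1. *)
have FF : cvg F.
  by apply: contrapT => /dvgP E; move: F1; rewrite E lte_fin ltr10.
have : nbhs (lim F) [set y : \bar R | (1 < y)%E].
  by apply: open_nbhs_nbhs; split=> //; exact: open_ereal_gt_ereal.
move=> /FF; rewrite /F /= /within /= => hr.
suff [r [r0 rr h1]] : exists r : R, [/\ 0 < r, (r%:E < conv_radius U)%E &
    (1 < (reC (gf_val U (toC r) 0 i))%:E)%E].
  exists r; split=> //; have [s rs gs] := summable_beyond (ltW r0) rr.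
  have gr : summable_at U r by apply: (summable_le wf sol gs); rewrite (ltW r0) ltW.
  by rewrite (gf_val_uval wf sol)// lte_fin in h1.
(* A positive radius excludes the value -oo and leaves room for a positive [r] below a finite
   one. *)
move: hr rho0; case: (conv_radius U) => [rho| |]// hr rho0.
  have /nbhs_ballP[e /= e0 he] : nbhs (rho : R) (fun r : R => (r%:E < rho%:E)%E ->
    (1 < (reC (gf_val U (toC r) 0 i))%:E)%E) := hr.
  rewrite lte_fin in rho0.
  pose d := Num.min (e / 2) (rho / 2).
  have d0 : 0 < d by rewrite lt_min !divr_gt0.
  have de : d < e by rewrite gt_min ltr_pdivrMr// ltr_pMr// ltr1n.
  have dr : d < rho.
    by rewrite gt_min orbC ltr_pdivrMr// ltr_pMr// ltr1n.
  have rr : ((rho - d)%:E < rho%:E)%E by rewrite lte_fin gtrBl.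
  exists (rho - d); split; [by rewrite subr_gt0|exact: rr|].
  apply: he rr.
  by rewrite -ball_normE/= opprB addrCA subrr addr0 gtr0_norm.
have [M [_ hM]] : exists M : R, M \is Num.real /\ forall y : \bar R,
  (M%:E < y)%E -> (y < +oo)%E ->
  (1 < (reC (gf_val U (toC (fine y)) 0 i))%:E)%E := hr.
exists (`|M| + 1); split; [by rewrite ltr_wpDl|exact: ltry|].
apply: (hM (`|M| + 1)%:E); last exact: ltry.
by rewrite lte_fin (le_lt_trans (ler_norm M))// ltrDl.
Qed.

Lemma exists_uval_eq1 i : reC (gf_val U 0 0 i) < 1 ->
  (1 < value_at_radius U i)%E -> exists t : R,
  [/\ 0 < t, (t%:E < conv_radius U)%E & uval U t i = 1].
Proof.
rewrite gf_val0 mxE -/(ureal U i 0) -uval0 => u01.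
move=> /value_at_radius_gt1[r [r0 rr ur]].
have [s rs gs] := summable_beyond (ltW r0) rr.
have [||t] := @IVT _ (fun x => uval U x i) 0 r 1 (ltW r0).
- exact: uval_continuous gs (ltW r0) rs.
- by rewrite ge_min le_max (ltW u01) (ltW ur) orbT.
rewrite in_itv/= => /andP[t0 tr] ut; exists t; split=> //.
  rewrite lt_def t0 andbT; apply/eqP => t00.
  by move: u01; rewrite -t00 ut ltxx.
by apply: le_lt_trans rr; rewrite lee_fin.
Qed.

End Radius.

(** * The augmented system at (t, U(t)) *)

Section RealComparisons.
Variable R : realType.
Local Notation C := (Cplx R).

Lemma le_toCE (a b : C) (x y : R) : a = toC x -> b = toC y -> (a <= b) = (x <= y).
Proof. by move=> -> ->; rewrite le_toC. Qed.

Lemma lt_toCE (a b : C) (x y : R) : a = toC x -> b = toC y -> (a < b) = (x < y).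
Proof. by move=> -> ->; rewrite lt_toC. Qed.

Lemma ler_add_toC (a b : C) (x y d : R) : a = toC x -> b = toC y ->
  0 <= x -> 0 <= y -> x + d <= y -> `|a| + toC d <= `|b|.
Proof.
move=> -> -> x0 y0 xy; rewrite !norm_toC !ger0_norm//.
by rewrite -rmorphD/= le_toC.
Qed.

Lemma ler_toCB (s a b : C) (x y : R) : a = toC x -> b = toC y -> s <= a - b ->
  s <= toC (x - y).
Proof. by move=> -> ->; rewrite rmorphB. Qed.

Lemma entryB_toC n (u v : 'rV[C]_n) k (x y : R) :
  u 0 k = toC x -> v 0 k = toC y -> (u - v) 0 k = toC (x - y).
Proof. by move=> ux vy; rewrite !mxE ux vy rmorphB. Qed.

Lemma reC_toC_lin (I : finType) (a : R) (z : C) (f : I -> R) (g : I -> C) :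
  reC (toC a * z + \sum_k toC (f k) * g k) = a * reC z + \sum_k f k * reC (g k).
Proof.
rewrite raddfD raddf_sum/= reC_toCM; congr (_ + _).
by apply: eq_bigr => k _; rewrite reC_toCM.
Qed.

Lemma imC_toC_lin (I : finType) (a : R) (z : C) (f : I -> R) (g : I -> C) :
  imC (toC a * z + \sum_k toC (f k) * g k) = a * imC z + \sum_k f k * imC (g k).
Proof.
rewrite raddfD raddf_sum/= imC_toCM; congr (_ + _).
by apply: eq_bigr => k _; rewrite imC_toCM.
Qed.

End RealComparisons.

Lemma residual_algebra (K : comNzRingType) n (a b c d e : 'rV[K]_n) :
  a - c - (b - d) - (a - b - e) = - (c - d - e).
Proof. by apply/rowP => j; rewrite !mxE; ring. Qed.

Section Main.
Variables (R : realType) (m : nat) (h : system R m) (U : gf R m) (i : 'I_m).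
Local Notation C := (Cplx R).
Hypotheses (irr : irreducible_system h) (sol : gf_solution h U).

Let wf : well_founded_system h. Proof. by case: irr. Qed.
Let h_ge0 j k : 0 <= h j k. Proof. by have [_ ->] := wf. Qed.
Let u0 := ureal_ge0 wf sol.

Variable t : R.
Hypotheses (t_gt0 : 0 < t) (t_lt : (t%:E < conv_radius U)%E).
Hypotheses (ut1 : uval U t i = 1) (u0_lt1 : ureal U i 0 < 1).

(** Otherwise u would keep its value at 0, which is below 1, and could not be 1 at [t]. *)
Lemma nonconstant_coef : exists2 n, (0 < n)%N & 0 < ureal U i n.
Proof.
apply: contrapT => hn.
have [s ts gs] := summable_beyond wf sol (ltW t_gt0) t_lt.
have gt : summable_at U t by apply: (summable_le wf sol gs); rewrite (ltW t_gt0) ltW.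
have un n : (0 < n)%N -> ureal U i n = 0.
  move=> n0; apply/eqP; apply: contrapT => /negP un; apply: hn; exists n => //.
  by rewrite lt_def un u0.
suff : uval U t i <= ureal U i 0 by rewrite ut1 leNgt u0_lt1.
apply/(summable_uval_sup wf sol i gt) => -[|M]; first by rewrite /psum big_ord0.
rewrite /psum big_ord_recl/= expr0 mulr1 big1 ?addr0// => k _.
by rewrite un// mul0r.
Qed.

Lemma nonzero_coef j : exists n, 0 < ureal U j n.
Proof.
have [_ zf _ _] := irr; apply: contrapT => hn; apply: (zf U sol j).
have Uj n : U j n = 0.
  rewrite -(toC_ureal wf sol); have := u0 j n; rewrite le_eqVlt => /orP[/eqP <-|un].
    exact: rmorph0.
  by exfalso; apply: hn; exists n.
near=> z; rewrite mxE; apply: (@lim_near_cst C) => //.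
exists 0%N => // N _ /=; rewrite /series/= big1// => n _.
by rewrite Uj mul0r.
Unshelve. all: by end_near. Qed.

Lemma upoint_gt0 x : summable_at U x -> 0 < x -> forall l, 0 < upoint U x 0 l.
Proof.
move=> gx x0 l; rewrite (upointE wf sol gx) toC_gt0.
apply: (@zU_fun_all _ _ (fun c => 0 < c)) => // j; have [n un] := nonzero_coef j.
exact: uval_gt0 wf sol _ _ _ gx x0 un.
Qed.

(** Strict growth of u_i travels backwards along the dependency edges: if H_j involves U_k and u_k
    grows strictly, so does u_j = H_j(z, U). Every vertex reaches [i]. *)
Lemma upoint_lt x y : summable_at U y -> 0 < x -> x < y ->
  forall l, upoint U x 0 l < upoint U y 0 l.
Proof.
move=> gy x0 xy.
have xy' : 0 <= x <= y by rewrite !ltW.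
have gx := summable_le wf sol gy xy'.
have le l : upoint U x 0 l <= upoint U y 0 l.
  rewrite (le_toCE (upointE wf sol gx l) (upointE wf sol gy l)) /zU_fun.
  by case: fintype.split => [_|j]; [exact: (ltW xy)|exact: (uval_le wf sol j gy xy')].
have ui : uval U x i < uval U y i.
  have [n n0 un] := nonconstant_coef.
  exact: uval_lt wf sol _ _ _ _ gy (ltW x0) xy n0 un.
have step j k : dependency_graph h j k -> uval U x k < uval U y k ->
    uval U x j < uval U y j.
  move=> /asboolP[k' [k'k hk']] uk.
  have [cx ex] := sol_extends wf sol j gx; have [cy ey] := sol_extends wf sol j gy.
  rewrite -(lt_toCE ex ey).
  apply: (msum_lt h_ge0 (upoint_gt0 gx x0) le (abs_cvg_msum cx)
    (abs_cvg_msum cy) k'k hk').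
  by rewrite (lt_toCE (upointE wf sol gx _) (upointE wf sol gy _)) !zU_fun_rshift.
have uj j : uval U x j < uval U y j.
  have [_ _ _ /(_ j i)/connectP[p]] := irr.
  elim: p j => [|k p IH] j /=; first by move=> _ <-.
  by move=> /andP[jk kp] ip; exact: step jk (IH k kp ip).
move=> l; rewrite (lt_toCE (upointE wf sol gx l) (upointE wf sol gy l)) /zU_fun.
by case: fintype.split.
Qed.

(** A displacement smaller than every gap between [upoint U x] and [upoint U y] keeps the moduli of
    all entries below those of [upoint U y], where H converges absolutely. *)
Lemma upoint_conv_dom x y : summable_at U y -> 0 < x -> x < y -> conv_dom h (upoint U x).
Proof.
move=> gy x0 xy; have lt := upoint_lt gy x0 xy.
have xy' : 0 <= x <= y by rewrite !ltW.
have gx := summable_le wf sol gy xy'.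
pose f l := zU_fun y (uval U y) l - zU_fun x (uval U x) l.
have [|d d0 df] := @fin_positive_lower_bound _ _ f.
  move=> l; rewrite subr_gt0 -(lt_toCE (upointE wf sol gx l) (upointE wf sol gy l)).
  exact: lt.
apply/nbhs_ballP; exists (toC d); first by rewrite /= toC_gt0.
move=> z; rewrite -ball_normE/= => zd j.
have [cy _] := sol_extends wf sol j gy.
apply: abs_cvg_le cy => l.
have -> : z 0 l = upoint U x 0 l - (upoint U x - z) 0 l.
  by rewrite [X in _ - X]mxE [X in _ - (_ + X)]mxE opprB addrCA subrr addr0.
apply: le_trans (ler_normB _ _) _.
apply: le_trans (lerD (lexx _) (le_trans (ler_entry_norm _ _ _) (ltW zd))) _.
apply: (ler_add_toC (upointE wf sol gx l) (upointE wf sol gy l)).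
- exact: (zU_fun_uval_ge0 wf sol gx l).
- exact: (zU_fun_uval_ge0 wf sol gy l).
- by rewrite -lerBrDl; exact: df.
Qed.

Lemma exists_z_dependence : exists j (k : {ffun 'I_(1 + m) -> nat}),
  (0 < k (lshift m ord0))%N /\ h j k != 0.
Proof.
apply: contrapT => hn; have [n n0] := nonconstant_coef.
rewrite /ureal (@no_z_constant _ _ h U wf sol)// ?ltxx//.
move=> j k k0; apply/eqP; apply: contrapT => /negP hjk.
by apply: hn; exists j, k.
Qed.

(** Two points beyond [t] are needed: [s1] provides the supersolution U(s1) - U(t), and [s2] makes
    the point over [s1] interior, as convexity between [t] and [s1] requires. *)
Let gt : exists s1 s2, [/\ t < s1, s1 < s2, summable_at U s1 & summable_at U s2].
Proof.
have [s ts gs] := summable_beyond wf sol (ltW t_gt0) t_lt.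
exists ((t + s) / 2), s; split=> //; [lra|lra|].
by apply: (summable_le wf sol gs); have := t_gt0; lra.
Qed.

Let zeta := upoint U t.

Lemma zeta_conv_dom : conv_dom h zeta.
Proof. by have [s1 [s2 [ts1 _ gs1 _]]] := gt; exact: upoint_conv_dom gs1 _ ts1. Qed.

Lemma zeta_summable : summable_at U t.
Proof.
have [s1 [s2 [ts1 _ gs1 _]]] := gt.
by apply: (summable_le wf sol gs1); rewrite !ltW.
Qed.

Lemma zeta_gt0 l : 0 < zeta 0 l. Proof. exact: upoint_gt0 zeta_summable t_gt0 l. Qed.

Definition jac (j : 'I_m) (l : 'I_(1 + m)) : R := reC (mgrad (h j) l zeta).

Lemma zeta_bounded_beyond : exists2 d, 0 < d & bounded_beyond h zeta (d + d).
Proof.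
by apply: conv_dom_bounded_beyond zeta_conv_dom _ => l; rewrite ltW ?zeta_gt0.
Qed.

Lemma toC_jac j l : toC (jac j l) = mgrad (h j) l zeta.
Proof.
have [d d0 hd] := zeta_bounded_beyond.
rewrite -ge0_toC//; apply: (mgrad_ge0 _ _ (addr_gt0 d0 d0) h_ge0) hd => l'.
by rewrite ltW ?zeta_gt0.
Qed.

Lemma jac_ge0 j l : 0 <= jac j l.
Proof.
have [d d0 hd] := zeta_bounded_beyond; rewrite reC_ge0//.
apply: (mgrad_ge0 _ _ (addr_gt0 d0 d0) h_ge0) hd => l'.
by rewrite ltW ?zeta_gt0.
Qed.

Lemma jac_gt0 j l (k : {ffun 'I_(1 + m) -> nat}) :
  (0 < k l)%N -> h j k != 0 -> 0 < jac j l.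
Proof.
move=> kl hk; rewrite -toC_gt0 toC_jac.
have [d d0 hd] := zeta_bounded_beyond.
exact: mgrad_gt0 (addr_gt0 d0 d0) h_ge0 zeta_gt0 hd kl hk.
Qed.

Local Notation M := (fun j k => jac j (rshift 1 k)).
Local Notation Hz := (fun j => jac j (lshift m ord0)).

(** Convexity gives (s1 - t) Hz_j + (M w)_j <= w_j for w = U(s1) - U(t). The first term is positive
    for any equation that depends on z. *)
Lemma exists_supersolution : exists w : 'I_m -> R,
  [/\ forall j, 0 < w j, forall j, \sum_k M j k * w k <= w j &
      exists j, \sum_k M j k * w k < w j].
Proof.
have [s1 [s2 [ts1 s12 gs1 gs2]]] := gt.
pose w j := uval U s1 j - uval U t j; exists w.
have lt := upoint_lt gs1 t_gt0 ts1.
have s10 : 0 < s1 by apply: lt_trans ts1.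
have [d d0 hd] : exists2 d, 0 < d & bounded_beyond h (upoint U s1) (d + d).
  apply: conv_dom_bounded_beyond; first exact: upoint_conv_dom gs2 s10 s12.
  by move=> l; rewrite ltW ?upoint_gt0.
have key j : (s1 - t) * Hz j + \sum_k M j k * w k <= w j.
  have := @msum_convex _ _ h zeta (upoint U s1) (d + d) j (addr_gt0 d0 d0) h_ge0
    (fun l => ltW (zeta_gt0 l)) (fun l => ltW (lt l)) hd.
  have [_ e1] := sol_extends wf sol j gs1.
  have [_ e2] := sol_extends wf sol j zeta_summable.
  move=> /(ler_toCB e1 e2); rewrite big_split_ord/= big_ord1.
  have -> : (upoint U s1 - zeta) 0 (lshift m ord0) = toC (s1 - t).
    by rewrite zU_pointB zU_point_l rmorphB.
  have -> : \sum_(k < m) (upoint U s1 - zeta) 0 (rshift 1 k) *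
      mgrad (h j) (rshift 1 k) zeta = toC (\sum_k M j k * w k).
    rewrite rmorph_sum; apply: eq_bigr => k _.
    rewrite zU_pointB zU_point_r -toC_jac [RHS]rmorphM/= mulrC; congr (_ * _).
    exact: entryB_toC (gf_val_uval wf sol k gs1) (gf_val_uval wf sol k zeta_summable).
  by rewrite -toC_jac -rmorphM/= -rmorphD/= le_toC.
have st : 0 < s1 - t by rewrite subr_gt0.
split=> [j|j|].
- have := lt (rshift 1 j).
  rewrite (lt_toCE (upointE wf sol zeta_summable _) (upointE wf sol gs1 _)).
  by rewrite !zU_fun_rshift subr_gt0.
- apply: le_trans (key j); rewrite lerDr.
  exact: mulr_ge0 (ltW st) (jac_ge0 _ _).
- have [j [k [k0 hk]]] := exists_z_dependence.
  exists j; apply: lt_le_trans (key j); rewrite ltrDr mulr_gt0//.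
  exact: jac_gt0 k0 hk.
Qed.

Lemma jacobian_sign (v : 'I_m -> R) : (forall j, \sum_k M j k * v k <= v j) ->
  (forall j, v j = 0) \/ (forall j, 0 < v j).
Proof.
have [w [w0 Mw Mw1]] := exists_supersolution.
have [_ _ _ ec] := irr.
apply: (@supersolution_sign _ _ M (dependency_graph h) w v) => //.
- by move=> j k; exact: jac_ge0.
- by move=> j k /asboolP[k' [k'k hk']]; exact: jac_gt0 k'k hk'.
Qed.

(* [(a, v)] is a real kernel vector of the augmented Jacobian; the sign of [v] is
   that of [a], so that [v i = 0] forces both to vanish. *)
Lemma real_kernel (a : R) (v : 'I_m -> R) : v i = 0 ->
  (forall j, v j = Hz j * a + \sum_k M j k * v k) ->
  a = 0 /\ forall j, v j = 0.
Proof.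
wlog a0 : a v / 0 <= a.
  move=> H vi hv; have [a0|/ltW a0] := leP 0 a; first exact: H.
  have [||j|/eqP] := H (- a) (fun j => - v j).
  - by rewrite oppr_ge0.
  - by rewrite vi oppr0.
  - have E : \sum_k M j k * - v k = - \sum_k M j k * v k.
      by rewrite -sumrN; apply: eq_bigr => k _; rewrite mulrN.
    by rewrite E mulrN -opprD -hv.
  rewrite oppr_eq0 => /eqP -> hj; split=> // j; apply/eqP.
  by rewrite -oppr_eq0 hj.
move=> vi hv.
have [|v0|vpos] := @jacobian_sign v.
- by move=> j; rewrite [leRHS]hv lerDr mulr_ge0 ?jac_ge0.
- split=> //; have [j [k [k0 hk]]] := exists_z_dependence.
  have := hv j; rewrite v0 big1 ?addr0; last by move=> l _; rewrite v0 mulr0.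
  move/esym/eqP; rewrite mulf_eq0 => /orP[|/eqP//].
  by rewrite gt_eqF ?(jac_gt0 k0 hk).
- by have := vpos i; rewrite vi ltxx.
Qed.

(** Rows are indexed by variables, as for the library Jacobian: the first column differentiates U_i
    - 1, the others U - H. *)
Definition aug_grad (x : 'rV[C]_(1 + m)) : 'M[C]_(1 + m) :=
  row_mx (col (rshift 1 i) 1%:M) (col_mx 0 1%:M - sysgrad h x).

Lemma mul_aug_grad (e x : 'rV[C]_(1 + m)) :
  e *m aug_grad x = zU_point (rsubmx e 0 i) (rsubmx e - e *m sysgrad h x).
Proof.
rewrite /aug_grad /zU_point mul_mx_row mulmxBr; congr row_mx.
  rewrite colE mul1mx -colE; apply/matrixP => a b.
  by rewrite !ord1 mx11_scalar_entry !mxE.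
congr (_ - _); rewrite -[in LHS](hsubmxK e) mul_row_col mulmx0 add0r.
by rewrite mulmx1.
Qed.

(** The entries at [zeta] are real, so the real and imaginary parts of a complex kernel vector both
    fall under [real_kernel]. *)
Lemma aug_grad_unit : aug_grad zeta \in unitmx.
Proof.
apply: unitmx_of_injective => e; rewrite mul_aug_grad => e0.
have ei : rsubmx e 0 i = 0.
  by have := zU_point_l (rsubmx e 0 i) (rsubmx e - e *m sysgrad h zeta) ord0;
    rewrite e0 mxE => <-.
have ej j : rsubmx e 0 j = toC (Hz j) * e 0 (lshift m ord0) +
    \sum_k toC (M j k) * rsubmx e 0 k.
  have := zU_point_r (rsubmx e 0 i) (rsubmx e - e *m sysgrad h zeta) j.
  rewrite e0 mxE => /esym/eqP; rewrite mxE [X in _ + X]mxE subr_eq0 => /eqP ->.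
  rewrite mxE big_split_ord/= big_ord1; congr (_ + _).
    by rewrite mxE toC_jac mulrC.
  by apply: eq_bigr => k _; rewrite [in LHS]mxE [in RHS]mxE toC_jac mulrC.
have [a_re v_re] : reC (e 0 (lshift m ord0)) = 0 /\
    forall j, reC (rsubmx e 0 j) = 0.
  apply: real_kernel => [|j]; first by rewrite ei.
  exact: etrans (congr1 (@reC R) (ej j)) (reC_toC_lin _ _ _ _).
have [a_im v_im] : imC (e 0 (lshift m ord0)) = 0 /\
    forall j, imC (rsubmx e 0 j) = 0.
  apply: real_kernel => [|j]; first by rewrite ei.
  exact: etrans (congr1 (@imC R) (ej j)) (imC_toC_lin _ _ _ _).
apply/rowP => l; rewrite [RHS]mxE; case: (split_ordP l) => k ->.
  by rewrite (ord1 k); apply: reC_imC_eq.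
have -> : e 0 (rshift 1 k) = rsubmx e 0 k by rewrite mxE.
by apply: reC_imC_eq.
Qed.

(** U_i - 1 and U are affine and leave no remainder; what is left is that of H up to sign, with the
    same constant. *)
Lemma aug_quad_approx d B : 0 <= B ->
  quad_approx (sys_map h) (sysgrad h) zeta d B ->
  quad_approx (augmented_map h i) aug_grad zeta d B.
Proof.
move=> B0 q x y xd yd; rewrite mul_aug_grad /augmented_map.
rewrite !zU_pointB.
have -> : rsubmx y 0 i - 1 - (rsubmx x 0 i - 1) - rsubmx (y - x) 0 i = 0.
  by rewrite !mxE; ring.
have -> : rsubmx (y - x) = rsubmx y - rsubmx x by exact: raddfB.
rewrite residual_algebra.
have Byx : 0 <= B * `|y - x| ^+ 2 by rewrite mulr_ge0 ?exprn_ge0.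
apply: norm_zU_point => //; first by rewrite normr0.
by rewrite normrN; exact: q.
Qed.

Lemma newton_at_zeta :
  newton_cvg_quadratically_near (augmented_map h i) (conv_dom h) zeta.
Proof.
have [d d0 hd] := zeta_bounded_beyond.
have [B B0 q] := sys_quad_approx d0 (fun l => ltW (zeta_gt0 l)) hd.
have : nbhs zeta (conv_dom h).
  apply: open_nbhs_nbhs; split; [exact: open_interior|exact: zeta_conv_dom].
move=> /nbhs_ballP[e /= e0 he]; have e0' := ltW e0.
rewrite (ge0_toC e0') toC_gt0 in e0 he.
(* Within [d / 2] the expansion holds; within [reC e] the points stay in the domain of
   convergence. *)
pose r := Num.min (d / 2) (reC e).
have r0 : 0 < toC r by rewrite toC_gt0 lt_min e0 divr_gt0.
have rd : toC r <= toC (d / 2) by rewrite le_toC ge_min lexx.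
have re : toC r <= toC (reC e) by rewrite le_toC ge_min lexx orbT.
have gt_ := zeta_summable.
apply: (newton_quadratic r0 B0 (L := aug_grad)).
- apply: aug_quad_approx => // x y xr yr; apply: q.
    exact: lt_le_trans xr rd.
  exact: lt_le_trans yr rd.
- move=> x xr; apply: he; rewrite -ball_normE/= distrC.
  exact: lt_le_trans xr re.
- have zr : rsubmx zeta = gf_val U (toC t) by rewrite row_mxKr.
  have hz : sys_map h zeta = gf_val U (toC t).
    apply/rowP => j; rewrite sys_mapE (gf_val_uval wf sol)//.
    by have [_ ->] := sol_extends wf sol j gt_.
  rewrite /augmented_map zr hz subrr (gf_val_uval wf sol)// ut1 rmorph1 subrr.
  by rewrite /zU_point raddf0 row_mx0.
- exact: aug_grad_unit.
Qed.

End Main.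

(* Hypothesis u0_lt1 is left implicit in the source; without it the system
   U = 2 + z * U, with solution 2 / (1 - z), is a counterexample. *)
Theorem theorem4p8 (R : realType) (m : nat) (h : system R m) (U : gf R m)
    (i : 'I_m)
    (h_irr : irreducible_system h)
    (U_sol : gf_solution h U)
    (u0_lt1 : reC (gf_val U 0 0 i) < 1)
    (urho_gt1 : (1 < value_at_radius U i)%E) :
  exists (t : R) (B : 'rV[R]_m),
    [/\ 0 < t /\ (t%:E < conv_radius U)%E,
        forall j, 0 <= B 0 j,
        gf_val U (toC t) 0 i = 1,
        map_mx (@toC R) B = gf_val U (toC t) &
        newton_cvg_quadratically_near (augmented_map h i) (conv_dom h)
          (zU_point (toC t) (map_mx (@toC R) B))].
Proof.
have wf : well_founded_system h by case: h_irr.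
have [t [t0 tr ut]] := exists_uval_eq1 wf U_sol u0_lt1 urho_gt1.
have u01 : ureal U i 0 < 1 by move: u0_lt1; rewrite gf_val0 mxE.
have gt := zeta_summable h_irr U_sol t0 tr.
have BE : map_mx (@toC R) (\row_j uval U t j) = gf_val U (toC t).
  by apply/rowP => j; rewrite (gf_val_uval wf U_sol)// !mxE.
exists t, (\row_j uval U t j); split.
- by [].
- by move=> j; rewrite mxE; exact: uval_ge0 wf U_sol _ _ gt.
- by rewrite (gf_val_uval wf U_sol)// ut rmorph1.
- exact: BE.
- have N := newton_at_zeta h_irr U_sol t0 tr ut u01.
  rewrite BE; exact: N.
Qed.
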